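(* Let $\mathfrak{R},\mathfrak{V},\mathfrak{S},\mathfrak{M}$ be as in the standard bond percolation setup described in the context, and let $\mathfrak{N}$ be a neighborhood collection for $\mathfrak{S}$. Suppose that (1) $(\mathfrak{R},\mathfrak{V},\mathfrak{S},\mathfrak{M},\mathfrak{N})$ is filling-compatible; (2) each measure in $\mathfrak{M}$ satisfies the FKG lattice condition; (3) each measure in $\mathfrak{M}\cup\mathfrak{M}^+(\mathfrak{S},\mathfrak{R})$ has the Markov property for blocking sets; (4) $\mathfrak{M}^+_w(\mathfrak{N},\mathfrak{R})$ has uniform exponential decay of connectivity. Then there exist constants $c,c',\epsilon>0$ (depending only on the collections) such that for all $\mathcal{R}\in\mathfrak{R}$, $P\in\mathfrak{M}_{\mathcal{R}}$, $\mathcal{V}\in\mathfrak{V}_{\mathcal{R}}$, all $r\ge c\log|\mathcal{V}|$, all $\mathcal{D}\subset\mathcal{R}$ with $\mathcal{D}^r(\mathcal{R})\subset\mathcal{V}$, and all events $A\in\mathcal{G}_{\mathcal{R}}$ and $B\in\mathcal{G}_{\mathcal{D}}$, each of which is increasing or decreasing, $$P(A\circ_r B)\le (1+c'e^{-\epsilon r})\,P(A)P(B).$$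
   Context: **Bonds, distances.** Sites are elements of $\mathbb{Z}^d$; a bond is an unordered pair $\langle xy\rangle$ of sites at Euclidean distance 1; $\mathcal{B}(\mathbb{Z}^d)$ is the set of all bonds. For a set $\mathcal{R}$ of bonds, $V(\mathcal{R})$ is the set of endpoints of bonds of $\mathcal{R}$. For $x,y\in V(\mathcal{R})$, $d_{\mathcal{R}}(x,y)$ is the minimum length of a path from $x$ to $y$ using only bonds of $\mathcal{R}$ ($\infty$ if there is none). This gives a distance between sets of sites (the infimum over pairs), and for sets of bonds $d_{\mathcal{R}}(\mathcal{E},\mathcal{F})=d_{\mathcal{R}}(V(\mathcal{E}),V(\mathcal{F}))$. For $\mathcal{D}\subset\mathcal{R}$, $\mathcal{D}^r(\mathcal{R})=\{b\in\mathcal{R}: d_{\mathcal{R}}(b,\mathcal{D})\le r\}$. **Configurations and events.** A bond configuration on $\mathcal{R}$ is $\omega\in\{0,1\}^{\mathcal{R}}$; a bond $e$ is open if $\omega_e=1$, closed if $\omega_e=0$. $\mathcal{G}_{\mathcal{D}}$ is the $\sigma$-algebra generated by $\omega_{\mathcal{D}}=(\omega_e)_{e\in\mathcal{D}}$. An event is increasing if $\omega\in A$, $\omega\le\omega'$ (coordinatewise) imply $\omega'\in A$, and decreasing if its complement is increasing. $A$ occurs on $\Theta\subset\mathcal{R}$ in $\omega$ if every $\omega'$ agreeing with $\omega$ on $\Theta$ is in $A$. $A\circ_r B$ is the event that there exist $\mathcal{E},\mathcal{F}\subset\mathcal{R}$ with $d_{\mathcal{R}}(\mathcal{E},\mathcal{F})\ge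 r$ such that $A$ occurs on $\mathcal{E}$ and $B$ occurs on $\mathcal{F}$ in $\omega$. $\rho^i$ denotes the configuration identically equal to $i$ ($i=0,1$), and $\rho^i_{\mathcal{E}}$ its restriction to $\mathcal{E}$. Conditional measures are understood for conditioning events of positive probability. **FKG lattice condition.** $P(\omega\vee\omega')P(\omega\wedge\omega')\ge P(\omega)P(\omega')$ for all $\omega,\omega'$ ($\vee,\wedge$ coordinatewise max and min). **Blocking.** A blocking partition of a set $\mathcal{R}$ of bonds is an ordered partition $(\mathcal{X},\mathcal{Y},\mathcal{Z})$ of $\mathcal{R}$ (parts may be empty) such that every path in $\mathcal{R}$ from $\mathcal{X}$ to $\mathcal{Z}$ (i.e. from a site of $V(\mathcal{X})$ to a site of $V(\mathcal{Z})$) includes at least one bond of $\mathcal{Y}$. A probability measure $P$ on $\{0,1\}^{\mathcal{R}}$ has the Markov property for blocking sets if for every blocking partition $(\mathcal{X},\mathcal{Y},\mathcal{Z})$ of $\mathcal{R}$, $\omega_{\mathcal{X}}$ and $\omega_{\mathcal{Z}}$ are conditionally independent given that all bonds of $\mathcal{Y}$ are closed. For $\mathcal{W}\subset\mathcal{R}$, $P$ has the Markov property for sets blocking $\mathcal{W}$ if this conditional independence holds for every blocking partition for which $\mathcal{W}\subset\mathcal{X}$ or $\mathcal{W}\subset\mathcal{Z}$. For $\mathcal{W}\subset\mathcal{E}\subset\mathcal{R}$, $\mathcal{W}$ is blockable in $\mathcal{E}$ under $P$ if for $i=0,1$ the measure $P(\omega_{\mathcal{E}}\in\cdot\mid\omega_{\mathcal{R}\setminus\mathcal{E}}=\rho^i_{\mathcal{R}\setminus\mathcal{E}})$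 on $\{0,1\}^{\mathcal{E}}$ has the Markov property for sets blocking $\mathcal{W}$. **Approximate neighborhoods.** For $x\in V(\mathcal{R})$, $B_{\mathcal{R}}(x,r)=\{\langle yz\rangle\in\mathcal{R}: d_{\mathcal{R}}(x,y)\le r,\ d_{\mathcal{R}}(x,z)\le r\}$. For $c>1$ and $r>0$, a $c$-approximate $r$-neighborhood of $x$ in $\mathcal{R}$ is a set $\mathcal{N}$ of bonds with $B_{\mathcal{R}}(x,r/c)\subset\mathcal{N}\subset B_{\mathcal{R}}(x,r)$; a $c$-approximate $r$-neighborhood of a bond is one of its endpoint closest to the origin. **Standard bond percolation setup.** $\mathfrak{R}$ is a collection of finite subsets of $\mathcal{B}(\mathbb{Z}^d)$. For each $\mathcal{R}\in\mathfrak{R}$: $\mathfrak{M}_{\mathcal{R}}$ is a collection of probability measures on $\{0,1\}^{\mathcal{R}}$, and $\mathfrak{V}_{\mathcal{R}}\subset\mathfrak{S}_{\mathcal{R}}$ are collections of subsets of $\mathcal{R}$, with $|\mathcal{V}|\ge2$ for all $\mathcal{V}\in\mathfrak{V}_{\mathcal{R}}$. $\mathfrak{M}=\bigcup_{\mathcal{R}\in\mathfrak{R}}\mathfrak{M}_{\mathcal{R}}$, $\mathfrak{V}=\{\mathfrak{V}_{\mathcal{R}}\}$, $\mathfrak{S}=\{\mathfrak{S}_{\mathcal{R}}\}$. $\mathfrak{N}$ is a collection of subsets of $\mathcal{B}(\mathbb{Z}^d)$; it is a neighborhood collection for $\mathfrak{S}$ if there exists $c>1$ such that for every $\mathcal{S}\in\mathfrak{R}\cup(\bigcup_{\mathcal{R}}\mathfrak{S}_{\mathcal{R}})$,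 $x\in V(\mathcal{S})$ and $r>0$, $\mathfrak{N}$ contains a $c$-approximate $r$-neighborhood of $x$ in $\mathcal{S}$. **Augmented collections.** $$\mathfrak{M}^+_w(\mathfrak{N},\mathfrak{R})=\{P(\omega_{\mathcal{N}}\in\cdot\mid\omega_{\mathcal{R}\setminus\mathcal{N}}=\rho^1_{\mathcal{R}\setminus\mathcal{N}}):\mathcal{N}\in\mathfrak{N},\ \mathcal{R}\in\mathfrak{R},\ \mathcal{N}\subset\mathcal{R},\ P\in\mathfrak{M}_{\mathcal{R}}\},$$ $$\mathfrak{M}^+(\mathfrak{S},\mathfrak{R})=\{P(\omega_{\mathcal{S}}\in\cdot\mid\omega_{\mathcal{R}\setminus\mathcal{S}}=\rho^i_{\mathcal{R}\setminus\mathcal{S}}):\mathcal{R}\in\mathfrak{R},\ \mathcal{S}\in\mathfrak{S}_{\mathcal{R}},\ P\in\mathfrak{M}_{\mathcal{R}},\ i=0,1\}.$$ A collection of measures, each on $\{0,1\}^{\mathcal{Q}}$ for some finite set $\mathcal{Q}$ of bonds, has uniform exponential decay of connectivity if there exist $C,\lambda>0$ such that for every measure $Q$ (on $\{0,1\}^{\mathcal{Q}}$) in the collection and all $x,y\in V(\mathcal{Q})$, $Q(x\text{ and }y\text{ are joined by a path of open bonds in }\mathcal{Q})\le Ce^{-\lambda d_{\mathcal{Q}}(x,y)}$. **Filling.** Given $\mathcal{R}\in\mathfrak{R}$, $P\in\mathfrak{M}_{\mathcal{R}}$, $\mathcal{S}\subset\mathcal{R}$, $c>1$, $r>0$, a bond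 $e\in\mathcal{R}\setminus\mathcal{S}$ is neighborhood-appendable to $\mathcal{S}$ for $(c,r,\mathcal{R},P,\mathfrak{N})$ if there is a $c$-approximate $r$-neighborhood $\mathcal{W}\in\mathfrak{N}$ of $e$ in $\mathcal{R}$ such that either $\mathcal{W}$ or $\mathcal{W}\setminus\mathcal{S}$ is blockable in $\mathcal{S}\cup\mathcal{W}$ under $P$. A set $\mathcal{V}\subset\mathcal{R}$ is fillable compatibly with $(c,r,\mathcal{R},P,\mathfrak{S}_{\mathcal{R}},\mathfrak{N})$ if there is an ordering $b_1,\dots,b_n$ of the bonds of $\mathcal{V}$ such that for all $0\le k<n$: (i) $\mathcal{S}_k=\{b_1,\dots,b_k\}\in\mathfrak{S}_{\mathcal{R}}$; (ii) $b_{k+1}$ is neighborhood-appendable to $\mathcal{S}_k$ for $(c,r,\mathcal{R},P,\mathfrak{N})$; (iii) every $e\in\mathcal{R}\setminus\mathcal{S}_k$ is neighborhood-appendable to $\mathcal{S}_k$ for $(c,r/4,\mathcal{R},P,\mathfrak{N})$. $(\mathfrak{R},\mathfrak{V},\mathfrak{S},\mathfrak{M},\mathfrak{N})$ is filling-compatible if for some $c>1$, for every $\mathcal{R}\in\mathfrak{R}$, $\mathcal{V}\in\mathfrak{V}_{\mathcal{R}}$, $P\in\mathfrak{M}_{\mathcal{R}}$ and every $r\ge1$, $\mathcal{V}$ is fillable compatibly with $(c,r,\mathcal{R},P,\mathfrak{S}_{\mathcal{R}},\mathfrak{N})$. *)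

(* Defs.v *)
From HB Require Import structures.
From mathcomp Require Import all_boot all_order all_algebra finmap.
From mathcomp Require Import all_classical all_reals all_analysis.

Set Implicit Arguments.
Unset Strict Implicit.
Unset Printing Implicit Defensive.

Import Order.TTheory GRing.Theory Num.Theory.

Local Open Scope classical_set_scope.
Local Open Scope ring_scope.

(** * Sites, bonds, distances *)

Definition site (d : nat) := 'rV[int]_d.

(* Squared Euclidean norm. *)
Definition sqnorm d (x : site d) : int := \sum_(i < d) x 0 i ^+ 2.

Definition is_bond d (e : {fset site d}) : bool :=
  (#|` e| == 2) &&
  [forall x : e, forall y : e, (x != y) ==> (sqnorm (val x - val y) == 1)].

Definition bond (d : nat) := {e : {fset site d} | is_bond e}.
HB.instance Definition _ (d : nat) := Choice.on (bond d).

Definition endpoints d (e : bond d) : {fset site d} := val e.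

Section Geometry.
Context {R : realType} {d : nat}.
Implicit Types (Q D E F : {fset bond d}) (x y : site d) (p : seq (site d)).

Definition vertices Q : {fset site d} := (\bigcup_(e <- Q) endpoints e)%fset.

Definition adj Q : rel (site d) :=
  fun x y => has (fun e => endpoints e == [fset x; y]%fset) Q.

(* [x :: p] is a path from [x] to [y] using only bonds of [Q]; its length is
   [size p]. *)
Definition is_path Q x p y : bool := path (adj Q) x p && (last x p == y).

Definition path_uses Q x p : bool := has id (pairmap (adj Q) x p).

Definition dist Q x y : \bar R :=
  ereal_inf [set ((size p)%:R)%:E | p in [set p | is_path Q x p y]].

Definition bond_dist Q E F : \bar R :=
  ereal_inf [set t | exists x y,
    [/\ x \in vertices E, y \in vertices F & t = dist Q x y]].

Definition enlarge Q D (r : R) : {fset bond d} :=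
  [fset b in Q | (bond_dist Q [fset b]%fset D <= r%:E)%E]%fset.

Definition ball_bonds Q x (r : R) : {fset bond d} :=
  [fset b in Q | [forall y : endpoints b,
                   (dist Q x (val y) <= r%:E)%E]]%fset.

Definition approx_nbhd (c r : R) Q x (N : {fset bond d}) : Prop :=
  (ball_bonds Q x (r / c) `<=` N)%fset /\ (N `<=` ball_bonds Q x r)%fset.

(* The two endpoints of a bond are never equidistant from the origin, so the
   point [x] below is unique. *)
Definition approx_nbhd_bond (c r : R) Q (e : bond d) (N : {fset bond d}) :=
  exists x, [/\ x \in endpoints e,
    forall y, y \in endpoints e -> sqnorm x <= sqnorm y &
    approx_nbhd c r Q x N].

End Geometry.

(** * Configurations and measures *)

Definition conf d (Q : {fset bond d}) := {ffun Q -> bool}.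

Section Configurations.
Context {d : nat}.
Implicit Types (Q E D : {fset bond d}).

(* State of an arbitrary bond; meaningful only for [b \in Q]. *)
Definition state Q (w : conf Q) (b : bond d) : bool :=
  if (insub b : option Q) is Some e then w e else false.

(* Only used with [E `<=` Q]. *)
Definition restr E {Q} (w : conf Q) : conf E := [ffun e : E => state w (val e)].

Definition rho (i : bool) E : conf E := [ffun=> i].

Definition conf_le Q (w w' : conf Q) : Prop := forall e, w e -> w' e.
Definition conf_join Q (w w' : conf Q) : conf Q := [ffun e => w e || w' e].
Definition conf_meet Q (w w' : conf Q) : conf Q := [ffun e => w e && w' e].

(* {0,1}^D is finite, so the sigma-algebra generated by the restriction to [D]
   is the class of all preimages under it. *)
Definition in_G D Q (A : set (conf Q)) : Prop :=
  exists A0 : set (conf D), A = restr D @^-1` A0.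

Definition increasing_event Q (A : set (conf Q)) : Prop :=
  forall w w', A w -> conf_le w w' -> A w'.

Definition decreasing_event Q (A : set (conf Q)) : Prop :=
  increasing_event (~` A).

Definition occurs_on Q (A : set (conf Q)) (T : {fset bond d}) (w : conf Q) :=
  forall w' : conf Q, restr T w' = restr T w -> A w'.

Definition disjoint_occurrence (R : realType) Q (r : R) (A B : set (conf Q)) :
    set (conf Q) :=
  [set w | exists E F : {fset bond d},
    [/\ (E `<=` Q)%fset, (F `<=` Q)%fset, (r%:E <= bond_dist Q E F)%E,
        occurs_on A E w & occurs_on B F w]].

Definition open_bonds Q (w : conf Q) : {fset bond d} :=
  [fset b in Q | state w b]%fset.

Definition joined Q (x y : site d) : set (conf Q) :=
  [set w | exists p, is_path (open_bonds w) x p y].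

End Configurations.

(* Probability mass functions. *)
Definition meas (R : realType) d (Q : {fset bond d}) := {ffun conf Q -> R}.

(* A collection of measures, those on {0,1}^Q being listed under [Q]. *)
Definition meas_coll (R : realType) d := forall Q : {fset bond d}, set (meas R Q).

Section Measures.
Context {R : realType} {d : nat}.
Implicit Types (Q E X Y Z W N S V : {fset bond d}).

Definition is_prob Q (P : meas R Q) : Prop :=
  (forall w, 0 <= P w) /\ \sum_w P w = 1.

Definition pr Q (P : meas R Q) (A : set (conf Q)) : R :=
  \sum_(w : conf Q | `[< A w >]) P w.

(* Meaningful only for [0 < pr P C]. *)
Definition cpr Q (P : meas R Q) (A C : set (conf Q)) : R :=
  pr P (A `&` C) / pr P C.

Definition FKG_lattice Q (P : meas R Q) : Prop :=
  forall w w', P w * P w' <= P (conf_join w w') * P (conf_meet w w').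

Definition outside i E {Q} : set (conf Q) :=
  [set w | restr (Q `\` E)%fset w = rho i (Q `\` E)%fset].

(* The law of the restriction to [E] given boundary condition [i] on [Q \ E];
   it is a probability measure only if [cond_defined i E P]. *)
Definition cond_meas i E Q (P : meas R Q) : meas R E :=
  [ffun h => cpr P [set w | restr E w = h] (outside i E)].

Definition cond_defined i E Q (P : meas R Q) : Prop := 0 < pr P (outside i E).

(** * Blocking *)

Definition blocking_partition Q X Y Z : Prop :=
  [/\ (X `|` Y `|` Z)%fset = Q,
      [/\ [disjoint X & Y]%fset, [disjoint X & Z]%fset & [disjoint Y & Z]%fset] &
      forall x z p, x \in vertices X -> z \in vertices Z ->
        is_path Q x p z -> path_uses Y x p].

(* Nothing is required when all bonds of [Y] are closed with probability 0. *)
Definition cond_indep_closed Q (P : meas R Q) X Y Z : Prop :=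
  let C := [set w : conf Q | restr Y w = rho false Y] in
  0 < pr P C ->
  forall (A : set (conf X)) (B : set (conf Z)),
    cpr P (restr X @^-1` A `&` restr Z @^-1` B) C =
    cpr P (restr X @^-1` A) C * cpr P (restr Z @^-1` B) C.

Definition markov_blocking Q (P : meas R Q) : Prop :=
  forall X Y Z, blocking_partition Q X Y Z -> cond_indep_closed P X Y Z.

Definition markov_sets_blocking W Q (P : meas R Q) : Prop :=
  forall X Y Z, blocking_partition Q X Y Z ->
    (W `<=` X)%fset \/ (W `<=` Z)%fset -> cond_indep_closed P X Y Z.

(* Both conditional measures must exist: if the condition were vacuous for a
   null boundary condition, filling would be possible with no information on
   the conditional measure in question. *)
Definition blockable W E Q (P : meas R Q) : Prop :=
  [/\ (W `<=` E)%fset, (E `<=` Q)%fset &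
   forall i, cond_defined i E P /\ markov_sets_blocking W (cond_meas i E P)].

(** * The percolation setup *)

(* [RR], [VV Q], [SS Q] are collections of finite sets of bonds; [NN] is a
   collection of arbitrary sets of bonds. *)
Implicit Types (RR : set {fset bond d}) (VV SS : {fset bond d} -> set {fset bond d}).
Implicit Types (MM : meas_coll R d) (NN : set (set (bond d))).

Definition standard_setup RR VV SS MM : Prop :=
  forall Q, RR Q ->
  [/\ forall P, MM Q P -> is_prob P,
      VV Q `<=` SS Q,
      forall S, SS Q S -> (S `<=` Q)%fset &
      forall V, VV Q V -> (2 <= #|` V|)%N].

Definition neighborhood_collection RR SS NN : Prop :=
  exists2 c : R, 1 < c &
  forall S, RR S \/ (exists2 Q, RR Q & SS Q S) ->
  forall x, x \in vertices S -> forall r : R, 0 < r ->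
  exists2 N : {fset bond d}, NN [set` N] & approx_nbhd c r S x N.

Definition all_meas RR MM : meas_coll R d :=
  fun Q => [set P | RR Q /\ MM Q P].

Definition wired_aug NN RR MM : meas_coll R d :=
  fun N => [set mu | NN [set` N] /\ exists Q (P : meas R Q),
    [/\ RR Q, (N `<=` Q)%fset, MM Q P,
        cond_defined true N P & mu = cond_meas true N P]].

Definition full_aug SS RR MM : meas_coll R d :=
  fun S => [set mu | exists Q (P : meas R Q) i,
    [/\ RR Q, SS Q S, MM Q P, cond_defined i S P & mu = cond_meas i S P]].

Definition uniform_exp_decay (KK : meas_coll R d) : Prop :=
  exists C lambda : R, [/\ 0 < C, 0 < lambda &
  forall Q (mu : meas R Q), KK Q mu ->
  forall x y, x \in vertices Q -> y \in vertices Q ->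
    ((pr mu (joined x y))%:E <=
       C%:E * expeR (- (lambda%:E * dist Q x y)))%E].

(** * Filling *)

Definition appendable (c r : R) Q (P : meas R Q) NN S (e : bond d) : Prop :=
  exists W : {fset bond d},
  [/\ NN [set` W], approx_nbhd_bond c r Q e W &
      blockable W (S `|` W)%fset P \/
      blockable (W `\` S)%fset (S `|` W)%fset P].

(* [b] lists the bonds of [V]; with 0-based indices, [tnth b k] is the bond
   following the first [k]. *)
Definition fillable (c r : R) Q (P : meas R Q)
    (SQ : set {fset bond d}) NN V : Prop :=
  exists2 b : (#|` V|).-tuple (bond d), perm_eq b V &
  forall k : 'I_(#|` V|),
  let S := [fset e in take k b]%fset in
  [/\ SQ S,
      appendable c r P NN S (tnth b k) &
      forall e, e \in (Q `\` S)%fset -> appendable c (r / 4) P NN S e].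

Definition filling_compatible RR VV SS MM NN : Prop :=
  exists2 c : R, 1 < c &
  forall Q, RR Q -> forall V, VV Q V -> forall P, MM Q P ->
  forall r : R, 1 <= r -> fillable c r P (SS Q) NN V.

End Measures.

(* Main.v *)
(* If one of A, B is increasing and the other decreasing, FKG gives P(A o_r B) <=
   P(A and B) <= P(A)P(B).  Otherwise a configuration in A o_r B carries witnesses E, F at
   distance r, and we run the van den Berg-Kesten replacement argument on two copies of
   the configuration: at first they share their states on all bonds of D, at the end they
   are independent, and the shared bonds b are decoupled one at a time.  One of E, F is
   far from b, and the step needs nu_1(G) <= (1 + small) nu_0(G) for increasing G far from
   b (nu_0(G) <= (1 + small) nu_1(G) for decreasing G), where
   nu_1, nu_0 are the laws given the revealed bonds and the state of b.  The cluster
   of b in nu_1 has a closed boundary, beyond which the Markov property and FKG allow the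
   comparison with nu_0, unless the cluster reaches G.  Every path from b to the far
   witness crosses the moat between E and F, so it contains a site x joined to a remote
   site in a neighborhood of x that avoids E and F; there the wired measure, which dominates
   every conditional law, has exponential decay.

   A given partial revelation may make such connections likely.  A site x is called good
   if, given the revealed bonds, they have probability at most delta for every state
   of the bonds off the neighborhood of x.  By Markov's inequality in the wired
   measure a site is bad with small probability conditionally on everything off its
   neighborhood, hence also conditionally on witnesses avoiding it; so bad sites can be
   excluded in the single configuration, before it is doubled, by a union bound over
   sites and steps, and only witness pairs whose moat is good are kept along the induction.
   The union bounds cost powers of |V|, absorbed by r >= c log |V|. *)
Require Import Defs.
From mathcomp Require Import all_boot all_order all_algebra.
From mathcomp Require Import ring lra.
Set Implicit Arguments.
Unset Strict Implicit.
Unset Printing Implicit Defensive.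
Import Order.TTheory GRing.Theory Num.Theory.
Local Open Scope ring_scope.

(** * Lattice measures on configurations *)

(** One coordinate of the four functions theorem. Put [x = a0 * b1], [y = a1 * b0], [w = c1 * d0],
    [z = c0 * d1]: the two diagonal bounds multiply to [x * y <= w * z], and
    [(w - x) * (w - y) >= 0] then yields [x + y <= w + z]. If [w = 0], both [x] and [y] vanish. *)
Lemma two_point (R : realFieldType) (a0 a1 b0 b1 c0 c1 d0 d1 : R) :
  0 <= a0 -> 0 <= a1 -> 0 <= b0 -> 0 <= b1 ->
  0 <= c0 -> 0 <= c1 -> 0 <= d0 -> 0 <= d1 ->
  a0 * b0 <= c0 * d0 -> a0 * b1 <= c1 * d0 -> a1 * b0 <= c1 * d0 ->
  a1 * b1 <= c1 * d1 ->
  (a0 + a1) * (b0 + b1) <= (c0 + c1) * (d0 + d1).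
Proof.
move=> a0p a1p b0p b1p c0p c1p d0p d1p h00 h01 h10 h11.
have [w0|wn0] := eqVneq (c1 * d0) 0.
  have : 0 <= a0 * b1 by exact: mulr_ge0.
  have : 0 <= a1 * b0 by exact: mulr_ge0.
  have : 0 <= c0 * d1 by exact: mulr_ge0.
  by rewrite w0 in h01 h10; rewrite !mulrDr !mulrDl; lra.
have wp : 0 < c1 * d0 by rewrite lt_def wn0 mulr_ge0.
have pr : (a0 * b1) * (a1 * b0) <= (c0 * d1) * (c1 * d0).
  have := ler_pM (mulr_ge0 a0p b0p) (mulr_ge0 a1p b1p) h00 h11.
  rewrite (_ : a0 * b0 * _ = a0 * b1 * (a1 * b0)); last by ring.
  by rewrite (_ : c0 * d0 * _ = c0 * d1 * (c1 * d0)) //; ring.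
have key : a0 * b1 + a1 * b0 <= c1 * d0 + c0 * d1.
  rewrite -(ler_pM2r wp); nra.
rewrite !mulrDr !mulrDl; lra.
Qed.

Section Configurations.
Context {R : realFieldType} {I : finType}.
Implicit Types (s t w : {ffun I -> bool}) (T S : {set I}) (i b : I) (j : bool).
Implicit Types (f g P : {ffun I -> bool} -> R) (G H L : pred {ffun I -> bool}).

Definition cjoin w w' : {ffun I -> bool} := [ffun e => w e || w' e].
Definition cmeet w w' : {ffun I -> bool} := [ffun e => w e && w' e].
Definition cle w w' := [forall e, w e ==> w' e].
Definition agree T w s := [forall e in T, w e == s e].
Definition upd s b j : {ffun I -> bool} := [ffun e => if e == b then j else s e].
(** Left unnormalized: conditional probabilities are compared by cross-multiplying masses, which
    stays meaningful for null conditioning events. *)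
Definition mass P G : R := \sum_(w | G w) P w.

Lemma cleP w w' : reflect (forall e, w e -> w' e) (cle w w').
Proof. by apply: (iffP forallP) => h e; [apply/implyP | apply/implyP/h]. Qed.

Lemma cle_joinl w w' : cle w (cjoin w w').
Proof. by apply/cleP => e; rewrite ffunE => ->. Qed.

Lemma cle_meetr w w' : cle (cmeet w w') w'.
Proof. by apply/cleP => e; rewrite ffunE => /andP[]. Qed.

Lemma cle_meetl w w' : cle (cmeet w w') w.
Proof. by apply/cleP => e; rewrite ffunE => /andP[]. Qed.

Lemma agreeP T w s : reflect {in T, w =1 s} (agree T w s).
Proof.
apply: (iffP forall_inP) => [h e eT|h e eT]; first exact/eqP/h.
exact/eqP/h.
Qed.

Lemma agree_refl T w : agree T w w.
Proof. exact/agreeP. Qed.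

Lemma agree_sym T w s : agree T w s = agree T s w.
Proof. by apply/agreeP/agreeP => h e eT; rewrite h. Qed.

Lemma agree_trans T w s t : agree T w s -> agree T s t -> agree T w t.
Proof. by move=> /agreeP h /agreeP k; apply/agreeP => e eT; rewrite h ?k. Qed.

Lemma agreeS T S w s : T \subset S -> agree S w s -> agree T w s.
Proof.
by move=> /subsetP TS /agreeP h; apply/agreeP => e eT; apply: h; apply: TS.
Qed.

Lemma agree_eqr T w s t : agree T s t -> agree T w s = agree T w t.
Proof.
move=> h; apply/idP/idP => k; first exact: agree_trans h.
by apply: agree_trans k _; rewrite agree_sym.
Qed.

Lemma agreeU T S w s : agree (T :|: S) w s = agree T w s && agree S w s.
Proof.
apply/agreeP/andP => [h|[/agreeP h /agreeP k] e].
  by split; apply/agreeP => e eT; apply: h; rewrite inE eT ?orbT.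
by rewrite inE => /orP[]; [exact: h|exact: k].
Qed.

Lemma agree_upd T w s b j :
  b \in T -> agree T w (upd s b j) = agree (T :\ b) w s && (w b == j).
Proof.
move=> bT; apply/agreeP/andP => [h|[/agreeP h /eqP wb] e eT].
  split; last by rewrite h // ffunE eqxx.
  apply/agreeP => e; rewrite !inE => /andP[eb eT].
  by rewrite h // ffunE (negbTE eb).
by rewrite ffunE; case: eqVneq => [->//|eb]; apply: h; rewrite !inE eb.
Qed.

Lemma agree_setT w s : agree [set: I] w s = (w == s).
Proof. by apply/agreeP/eqP => [h|-> //]; apply/ffunP => e; apply: h. Qed.

Lemma agree_set0 w s : agree (set0) w s.
Proof. by apply/agreeP => e; rewrite inE. Qed.

Lemma agree_joinmeet T w w' s s' : agree T w s -> agree T w' s' ->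
  agree T (cjoin w w') (cjoin s s') /\ agree T (cmeet w w') (cmeet s s').
Proof.
move=> /agreeP h /agreeP h'.
by split; apply/agreeP => e eT; rewrite !ffunE h ?h'.
Qed.

Lemma sum_agreeD1 f T s b : b \in T ->
  \sum_(w | agree (T :\ b) w s) f w =
  \sum_(w | agree T w (upd s b false)) f w +
  \sum_(w | agree T w (upd s b true)) f w.
Proof.
move=> bT; rewrite (bigID (fun w : {ffun I -> bool} => w b)) /= addrC.
congr (_ + _); apply: eq_bigl => w; rewrite agree_upd //.
  by case: (w b).
by case: (w b).
Qed.

Lemma cjoin_upd s t b j k : cjoin (upd s b j) (upd t b k) = upd (cjoin s t) b (j || k).
Proof. by apply/ffunP => e; rewrite !ffunE; case: eqP. Qed.

Lemma cmeet_upd s t b j k : cmeet (upd s b j) (upd t b k) = upd (cmeet s t) b (j && k).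
Proof. by apply/ffunP => e; rewrite !ffunE; case: eqP. Qed.

(* Ahlswede-Daykin, by summing out one coordinate at a time. *)
Lemma four_functions (fa fb fc fd : {ffun I -> bool} -> R) :
  (forall w, 0 <= fa w) -> (forall w, 0 <= fb w) ->
  (forall w, 0 <= fc w) -> (forall w, 0 <= fd w) ->
  (forall s t, fa s * fb t <= fc (cjoin s t) * fd (cmeet s t)) ->
  (\sum_w fa w) * (\sum_w fb w) <= (\sum_w fc w) * (\sum_w fd w).
Proof.
move=> a0 b0 c0 d0 h.
(* Induction on the number of coordinates still summed; those in [T] are fixed, on the right to the
   join and the meet. *)
have main n : forall T, #|~: T| = n -> forall s t,
    (\sum_(w | agree T w s) fa w) * (\sum_(w | agree T w t) fb w) <=
    (\sum_(w | agree T w (cjoin s t)) fc w) *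
    (\sum_(w | agree T w (cmeet s t)) fd w).
  elim: n => [|n IH] T cT s t.
    have -> : T = setT by rewrite -[T]setCK (cards0_eq cT) setC0.
    by do 4![rewrite (eq_bigl _ _ (fun w => agree_setT w _)) big_pred1_eq].
  have [i iT] : exists i, i \in ~: T by apply/card_gt0P; rewrite cT.
  have iT' : i \in i |: T by rewrite setU11.
  have -> : T = (i |: T) :\ i by rewrite setU1K //; rewrite inE in iT.
  have cT' : #|~: (i |: T)| = n.
    by move: cT; rewrite setCU setIC -setDE (cardsD1 i) iT => -[].
  rewrite !(sum_agreeD1 _ _ iT').
  have := IH _ cT' (upd s i _) (upd t i _); set U := i |: T => IHU.
  apply: two_point; do ?[exact: sumr_ge0].
  - by have := IHU false false; rewrite cjoin_upd cmeet_upd.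
  - by have := IHU false true; rewrite cjoin_upd cmeet_upd.
  - by have := IHU true false; rewrite cjoin_upd cmeet_upd.
  - by have := IHU true true; rewrite cjoin_upd cmeet_upd.
have := main _ set0 erefl [ffun=> false] [ffun=> false].
by do 4![rewrite (eq_bigl _ _ (fun w => agree_set0 w _))].
Qed.

End Configurations.

Section LatticeMeasure.
Context {R : realFieldType} {I : finType} {P : {ffun I -> bool} -> R}.
Hypothesis P_ge0 : forall w, 0 <= P w.
Hypothesis P_fkg : forall w w', P w * P w' <= P (cjoin w w') * P (cmeet w w').
Implicit Types (s t w : {ffun I -> bool}) (T S : {set I}) (i b : I) (j : bool).
Implicit Types (f g : {ffun I -> bool} -> R) (G H L : pred {ffun I -> bool}).

Lemma mass_ge0 G : 0 <= mass P G.
Proof. exact: sumr_ge0. Qed.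

Lemma mass_sub G H : (forall w, G w -> H w) -> mass P G <= mass P H.
Proof.
move=> GH; rewrite /mass big_mkcond [leRHS]big_mkcond /=; apply: ler_sum => w _.
by case: ifP => [/GH ->//|_]; case: ifP.
Qed.

Lemma eq_mass G H : G =1 H -> mass P G = mass P H.
Proof. by move=> GH; apply: eq_bigl. Qed.

Lemma massID G H :
  mass P G = mass P (fun w => G w && H w) + mass P (fun w => G w && ~~ H w).
Proof. exact: bigID. Qed.

Lemma mass_indic G H : mass P (fun w => G w && H w) = \sum_(w | G w) (H w)%:R * P w.
Proof.
rewrite /mass big_mkcondr; apply: eq_bigr => w _.
by case: (H w); rewrite (mul1r, mul0r).
Qed.

Lemma mass_union_le (K : finType) G (Gk : K -> pred {ffun I -> bool}) :
  (forall w, G w -> exists k, Gk k w) -> mass P G <= \sum_k mass P (Gk k).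
Proof.
move=> h; rewrite /mass; under [leRHS]eq_bigr do rewrite big_mkcond.
rewrite exchange_big /= big_mkcond; apply: ler_sum => w _; case: ifP => [Gw|_].
  have [k kw] := h _ Gw; rewrite (bigD1 k) //= kw lerDl.
  by apply: sumr_ge0 => i _; case: ifP.
by apply: sumr_ge0 => i _; case: ifP.
Qed.

Lemma mass_gt0 G w : G w -> 0 < P w -> 0 < mass P G.
Proof.
by move=> Gw Pw; rewrite /mass (bigD1 w) //= ltr_pwDl // sumr_ge0.
Qed.

(** Four functions theorem for [f P] and [P] restricted to [L] and [H]: the mean of [f] given the
    lower class is at most its mean given the upper class. Growth of [f] is needed only from an
    element of [L] to its join with an element of [H]. *)
Lemma holley_up L H f : (forall w, 0 <= f w) ->
  (forall s t, L s -> H t -> H (cjoin s t) && L (cmeet s t)) ->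
  (forall s t, L s -> H t -> f s <= f (cjoin s t)) ->
  (\sum_(w | L w) f w * P w) * mass P H <= (\sum_(w | H w) f w * P w) * mass P L.
Proof.
move=> f0 LH fm.
have := @four_functions _ _ (fun w => if L w then f w * P w else 0)
  (fun w => if H w then P w else 0) (fun w => if H w then f w * P w else 0)
  (fun w => if L w then P w else 0).
rewrite -!big_mkcond; apply => [w|w|w|w|s t];
  do ?by case: ifP => // _; rewrite ?mulr_ge0.
case: ifP => Ls; last by rewrite mul0r mulr_ge0 //; case: ifP; rewrite ?mulr_ge0.
case: ifP => Ht; last by rewrite mulr0 mulr_ge0 //; case: ifP; rewrite ?mulr_ge0.
have /andP[-> ->] := LH _ _ Ls Ht; rewrite -!mulrA.
by apply: ler_pM; rewrite ?mulr_ge0 //; apply: fm.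
Qed.

Lemma holley_down L H f : (forall w, 0 <= f w) ->
  (forall s t, L s -> H t -> H (cjoin s t) && L (cmeet s t)) ->
  (forall s t, L s -> H t -> f t <= f (cmeet s t)) ->
  (\sum_(w | H w) f w * P w) * mass P L <= (\sum_(w | L w) f w * P w) * mass P H.
Proof.
move=> f0 LH fm; rewrite mulrC [leRHS]mulrC.
have := @four_functions _ _ (fun w => if L w then P w else 0)
  (fun w => if H w then f w * P w else 0) (fun w => if H w then P w else 0)
  (fun w => if L w then f w * P w else 0).
rewrite -!big_mkcond; apply => [w|w|w|w|s t];
  do ?by case: ifP => // _; rewrite ?mulr_ge0.
case: ifP => Ls; last by rewrite mul0r mulr_ge0 //; case: ifP; rewrite ?mulr_ge0.
case: ifP => Ht; last by rewrite mulr0 mulr_ge0 //; case: ifP; rewrite ?mulr_ge0.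
have /andP[-> ->] := LH _ _ Ls Ht; rewrite mulrCA [leRHS]mulrCA.
by apply: ler_pM; rewrite ?mulr_ge0 //; apply: fm.
Qed.

Lemma mass_class T w s : agree T w s -> mass P ((agree T)^~ w) = mass P ((agree T)^~ s).
Proof. by move=> ws; apply: eq_mass => u; apply: agree_eqr. Qed.

(** Conditioning on the state of [T]: [H] is invariant under changes off [T], hence a union of the
    classes over which [G] is averaged. *)
Lemma mass_tower T H G : (forall w s, agree T w s -> H w -> H s) ->
  mass P (fun w => H w && G w) =
  \sum_(w | H w)
     P w * (mass P (fun s => agree T s w && G s) / mass P ((agree T)^~ w)).
Proof.
move=> HT.
transitivity (\sum_(w | H w) \sum_(s | H s && (agree T s w && G s))
                 P w * (P s / mass P ((agree T)^~ w))); last first.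
  apply: eq_bigr => w Hw; rewrite mulr_suml mulr_sumr; apply: eq_bigl => s.
  have [sw|] := boolP (agree T s w); last by rewrite andbF.
  by rewrite (HT w s) // agree_sym.
rewrite (exchange_big_dep (fun s => H s && G s)) /=; last first.
  by move=> w s Hw /andP[-> /andP[]].
apply: eq_bigr => s /andP[Hs Gs].
under eq_bigl => w do rewrite Hs Gs andbT.
transitivity (\sum_(w | agree T w s) P w * (P s / mass P ((agree T)^~ s))).
  (* In a null class the quotient takes the default value 0, and [P s] vanishes as well. *)
  have [ps|] := eqVneq (mass P ((agree T)^~ s)) 0.
    rewrite big1 => [|w _]; last by rewrite ps invr0 !mulr0.
    by move/psumr_eq0P: ps => -> //; apply: agree_refl.
  by move=> nz; rewrite -mulr_suml mulrC divfK.
symmetry; apply: congr_big => // w; first last.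
  by move=> /andP[_ ws]; rewrite -(mass_class ws).
apply/andP/idP => [[_]|ws]; first by rewrite agree_sym.
by split; [apply: (HT s w) => //; rewrite agree_sym | rewrite agree_sym].
Qed.

Lemma mass_class_le T H G (a : R) : (forall w s, agree T w s -> H w -> H s) ->
  (forall w, H w ->
     mass P (fun s => agree T s w && G s) <= a * mass P ((agree T)^~ w)) ->
  mass P (fun w => H w && G w) <= a * mass P H.
Proof.
move=> HT le; rewrite (mass_tower _ HT) [mass P H]/mass mulr_sumr.
apply: ler_sum => w Hw; have [->|Pw] := eqVneq (P w) 0; first by rewrite mul0r mulr0.
rewrite mulrC ler_wpM2r // ler_pdivrMr ?le //.
by apply: (@mass_gt0 _ w); rewrite ?agree_refl // lt_def Pw /=.
Qed.

Lemma mass_class_ge T H G (a : R) : (forall w s, agree T w s -> H w -> H s) ->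
  (forall w, H w -> 0 < P w ->
     a * mass P ((agree T)^~ w) <= mass P (fun s => agree T s w && G s)) ->
  a * mass P H <= mass P (fun w => H w && G w).
Proof.
move=> HT ge; rewrite (mass_tower _ HT) [mass P H]/mass mulr_sumr.
apply: ler_sum => w Hw; have [->|Pw] := eqVneq (P w) 0; first by rewrite mul0r mulr0.
have Pw_gt0 : 0 < P w by rewrite lt_def Pw /=.
rewrite mulrC ler_wpM2l // ler_pdivlMr ?ge //.
by apply: (@mass_gt0 _ w); rewrite ?agree_refl.
Qed.

(* Kantorovich duality without couplings: [t |-> max_(s <= t) f s] is monotone
   and lies between [f] and [g]. *)
Lemma cross_dom_up (L H : pred {ffun I -> bool}) f g :
  (forall s t, L s -> H t -> H (cjoin s t) && L (cmeet s t)) ->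
  (forall w, 0 <= g w) ->
  (forall s t, L s -> H t -> cle s t -> f s <= g t) ->
  (\sum_(w | L w) f w * P w) * mass P H <= (\sum_(w | H w) g w * P w) * mass P L.
Proof.
move=> LH g0 fg.
pose m t := \big[Num.max/0]_(s | L s && cle s t) f s.
have fm s : L s -> f s <= m s.
  by move=> Ls; apply: (le_bigmax_cond _ f); rewrite Ls; apply/cleP.
have mg t : H t -> m t <= g t.
  by move=> Ht; apply: bigmax_le => // s /andP[Ls st]; apply: fg.
have m0 w : 0 <= m w by exact: bigmax_ge_id.
have mm s t : L s -> H t -> m s <= m (cjoin s t).
  move=> _ _; apply: bigmax_le => // u /andP[Lu us].
  apply: (le_bigmax_cond _ f); rewrite Lu; apply/cleP => e ue.
  by rewrite ffunE (cleP _ _ us).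
apply: (@le_trans _ _ ((\sum_(w | L w) m w * P w) * mass P H)).
  by rewrite ler_wpM2r ?mass_ge0 //; apply: ler_sum => w Lw; rewrite ler_wpM2r ?fm.
apply: (le_trans (holley_up m0 LH mm)).
by rewrite ler_wpM2r ?mass_ge0 //; apply: ler_sum => w Hw; rewrite ler_wpM2r ?mg.
Qed.

Lemma cross_dom_down (L H : pred {ffun I -> bool}) f g :
  (forall s t, L s -> H t -> H (cjoin s t) && L (cmeet s t)) ->
  (forall w, 0 <= g w) ->
  (forall s t, L s -> H t -> cle s t -> f t <= g s) ->
  (\sum_(w | H w) f w * P w) * mass P L <= (\sum_(w | L w) g w * P w) * mass P H.
Proof.
move=> LH g0 fg.
pose m s := \big[Num.max/0]_(t | H t && cle s t) f t.
have fm s : H s -> f s <= m s.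
  by move=> Ls; apply: (le_bigmax_cond _ f); rewrite Ls; apply/cleP.
have mg t : L t -> m t <= g t.
  by move=> Ht; apply: bigmax_le => // s /andP[Ls st]; apply: fg.
have m0 w : 0 <= m w by exact: bigmax_ge_id.
have mm s t : L s -> H t -> m t <= m (cmeet s t).
  move=> _ _; apply: bigmax_le => // u /andP[Lu us].
  apply: (le_bigmax_cond _ f); rewrite Lu; apply/cleP => e.
  by rewrite ffunE => /andP[_ /(cleP _ _ us)].
apply: (@le_trans _ _ ((\sum_(w | H w) m w * P w) * mass P L)).
  by rewrite ler_wpM2r ?mass_ge0 //; apply: ler_sum => w Lw; rewrite ler_wpM2r ?fm.
apply: (le_trans (holley_down m0 LH mm)).
by rewrite ler_wpM2r ?mass_ge0 //; apply: ler_sum => w Hw; rewrite ler_wpM2r ?mg.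
Qed.

End LatticeMeasure.

(** * Comparison of expectations over two independent copies *)

Section TwoCopies.
Context {R : realFieldType} {O : finType} {mu0 mu1 : O -> R} {le : rel O}.
Implicit Types (f g : O -> R).

Definition expect (mu : O -> R) f : R := \sum_w f w * mu w.

Lemma expectD mu f g : expect mu (fun w => f w + g w) = expect mu f + expect mu g.
Proof. by rewrite -big_split; apply: eq_bigr => w _; rewrite mulrDl. Qed.

Lemma expectN mu f : expect mu (fun w => - f w) = - expect mu f.
Proof. by rewrite -sumrN; apply: eq_bigr => w _; rewrite mulNr. Qed.

Lemma expectB mu f g : expect mu (fun w => f w - g w) = expect mu f - expect mu g.
Proof. by rewrite expectD expectN. Qed.

Lemma expect_le mu f g : (forall w, 0 <= mu w) -> (forall w, f w <= g w) ->
  expect mu f <= expect mu g.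
Proof. by move=> mu_ge0 fg; apply: ler_sum => w _; rewrite ler_wpM2r. Qed.

Lemma expect_ge0 mu f : (forall w, 0 <= mu w) -> (forall w, 0 <= f w) ->
  0 <= expect mu f.
Proof. by move=> mu_ge0 f0; apply: sumr_ge0 => w _; rewrite mulr_ge0. Qed.

Lemma expectZ mu a f : expect mu (fun w => a * f w) = a * expect mu f.
Proof. by rewrite mulr_sumr; apply: eq_bigr => w _; rewrite mulrA. Qed.

Lemma eq_expect mu f g : f =1 g -> expect mu f = expect mu g.
Proof. by move=> fg; apply: eq_bigr => w _; rewrite fg. Qed.

Lemma expect_exchange mu nu (F : O -> O -> R) :
  expect mu (fun s => expect nu (F s)) = expect nu (fun t => expect mu (F^~ t)).
Proof.
rewrite /expect; under eq_bigr do rewrite mulr_suml.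
rewrite exchange_big; apply: eq_bigr => t _; rewrite mulr_suml.
by apply: eq_bigr => s _; rewrite mulrAC.
Qed.

Hypothesis mu0_ge0 : forall w, 0 <= mu0 w.
Hypothesis mu1_ge0 : forall w, 0 <= mu1 w.
Hypothesis cross : forall f g, (forall w, 0 <= g w) ->
  (forall s t, le s t -> f s <= g t) -> expect mu0 f <= expect mu1 g.
Variables (U V : rel O).
Hypothesis U_mono : forall s t s' t', le s s' -> le t t' -> U s t -> U s' t'.
Hypothesis V_mono : forall s t s' t', le s s' -> le t t' -> V s t -> V s' t'.
Hypothesis le_refl : forall s, le s s.

Local Notation E2 mu nu F := (expect mu (fun s => expect nu (fun t => (F s t : bool)%:R))).
Local Notation W := (fun s t => U s t || V s t).
Local Notation UV := (fun s t => U s t && V s t).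

Lemma expect_orb mu nu : E2 mu nu W = E2 mu nu U + E2 mu nu V - E2 mu nu UV.
Proof.
rewrite -expectD -expectB; apply: eq_expect => s; rewrite -expectD -expectB.
by apply: eq_expect => t; case: (U s t); case: (V s t); rewrite /=; ring.
Qed.

(** Pointwise, [W(s,t) + U(s',t) + V(s,t') <= W(s',t) + W(s,t') + UV(s',t')] whenever [s <= s'] and
    [t <= t']. A monotone coupling of [mu0] and [mu1] in each coordinate would integrate this;
    [cross] replaces the couplings, one coordinate at a time. *)
Lemma supermodular_step :
  E2 mu0 mu0 W + E2 mu1 mu0 U + E2 mu0 mu1 V <=
  E2 mu1 mu0 W + E2 mu0 mu1 W + E2 mu1 mu1 UV.
Proof.
have H : expect mu0 (fun s => expect mu0 (fun t => (W s t)%:R) -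
      expect mu1 (fun t => (W s t)%:R) + expect mu1 (fun t => (V s t)%:R)) <=
  expect mu1 (fun s => expect mu0 (fun t => (W s t)%:R) -
      expect mu0 (fun t => (U s t)%:R) + expect mu1 (fun t => (UV s t)%:R)).
  apply: cross => [s|s s' ss'].
    rewrite addr_ge0 ?expect_ge0 // subr_ge0 expect_le // => t.
    by case: (U s t); case: (V s t).
  suff : expect mu0 (fun t => (W s t)%:R - (W s' t)%:R + (U s' t)%:R) <=
     expect mu1 (fun t => (UV s' t)%:R + (W s t)%:R - (V s t)%:R).
    by rewrite !(expectD, expectN); lra.
  apply: cross => [t|t t' tt'].
    by case: (U s t); case: (V s t); case: (U s' t); case: (V s' t); rewrite /=; lra.
  apply: (@le_trans _ _ (W s t && U s' t)%:R).
    have := @U_mono s t s' t ss' (le_refl t); have := @V_mono s t s' t ss' (le_refl t).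
    case: (U s' t); case: (V s' t); case: (U s t); case: (V s t) => //= V1 U1;
    by [lra | have := U1 isT | have := V1 isT].
  apply: (@le_trans _ _ (W s t' && U s' t')%:R).
    rewrite ler_nat; case: andP => // -[W1 U1]; rewrite lt0b.
    rewrite (U_mono (le_refl s') tt' U1) andbT.
    case/orP: W1 => [/(U_mono (le_refl s) tt') -> //|].
    by move=> /(V_mono (le_refl s) tt') ->; rewrite orbT.
  have := @V_mono s t' s' t' ss' (le_refl t').
  case: (U s' t'); case: (V s t'); case: (V s' t'); case: (U s t') => //= V1;
  by [lra | have := V1 isT].
by move: H; rewrite !(expectD, expectN); lra.
Qed.

(** [U] tolerates a change of law in its second argument and [V] in its first, at the cost of a
    factor [k]. So [U] and [V] under [mu1, mu1] are paid for by [U] under [mu1, mu0] and [V] under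
    [mu0, mu1]; inclusion-exclusion and [supermodular_step] handle the overlap and the [mu0, mu0]
    term. *)
Lemma decoupling_step (k : R) : 0 <= k <= 1 ->
  (forall s, k * expect mu1 (fun t => (U s t)%:R) <= expect mu0 (fun t => (U s t)%:R)) ->
  (forall t, k * expect mu1 (fun s => (V s t)%:R) <= expect mu0 (fun s => (V s t)%:R)) ->
  k * (E2 mu1 mu1 W + E2 mu0 mu0 W) <= E2 mu1 mu0 W + E2 mu0 mu1 W.
Proof.
move=> /andP[k0 k1] hU hV.
have kU : k * E2 mu1 mu1 U <= E2 mu1 mu0 U.
  by rewrite -expectZ; apply: expect_le.
have kV : k * E2 mu1 mu1 V <= E2 mu0 mu1 V.
  rewrite expect_exchange -expectZ [leRHS]expect_exchange.
  exact: expect_le.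
have UW : E2 mu1 mu0 U <= E2 mu1 mu0 W.
  by do 2!apply: expect_le => // ?; rewrite ler_nat; case: (U _ _).
have VW : E2 mu0 mu1 V <= E2 mu0 mu1 W.
  by do 2!apply: expect_le => // ?; rewrite ler_nat orbC; case: (V _ _).
have := supermodular_step; rewrite (expect_orb mu1 mu1).
set a := E2 mu1 mu1 UV => sup.
have : k * (E2 mu0 mu0 W - a) <=
    k * (E2 mu1 mu0 W - E2 mu1 mu0 U + (E2 mu0 mu1 W - E2 mu0 mu1 V)).
  by rewrite ler_wpM2l //; lra.
have : k * (E2 mu1 mu0 W - E2 mu1 mu0 U) <= E2 mu1 mu0 W - E2 mu1 mu0 U.
  by rewrite ler_piMl ?subr_ge0.
have : k * (E2 mu0 mu1 W - E2 mu0 mu1 V) <= E2 mu0 mu1 W - E2 mu0 mu1 V.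
  by rewrite ler_piMl ?subr_ge0.
by rewrite !(mulrDr, mulrN); lra.
Qed.

End TwoCopies.

(** * Clusters and the Markov property *)

Section Clusters.
Context {R : realFieldType} {I W : finType} {ends : I -> {set W}}.
Context {P : {ffun I -> bool} -> R}.
Implicit Types (s t w : {ffun I -> bool}) (T S : {set I}) (e b : I) (c : {set W}).
Implicit Types (G H L A B : pred {ffun I -> bool}).

Definition open_rel w : rel W :=
  fun u v => [exists e, [&& w e, u \in ends e & v \in ends e]].

(** The ends of [b] belong to it even when [b] is closed. *)
Definition open_cluster w b : {set W} :=
  [set v | [exists u in ends b, connect (open_rel w) u v]].

Definition inner_bonds c : {set I} := [set e | ends e \subset c].
Definition outer_bonds c : {set I} := [set e | [disjoint ends e & c]].
Definition boundary_bonds c : {set I} := ~: (inner_bonds c :|: outer_bonds c).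
Definition closed_on S w := [forall e in S, ~~ w e].
Definition cut S w : {ffun I -> bool} := [ffun e => (e \in S) && w e].

Definition determined S A := forall w w', agree S w w' -> A w -> A w'.
Definition up_closed A := forall w w', cle w w' -> A w -> A w'.
Definition down_closed A := forall w w', cle w w' -> A w' -> A w.

Lemma ends_cluster w b : ends b \subset open_cluster w b.
Proof.
apply/subsetP => v vb; rewrite inE; apply/existsP; exists v.
by rewrite vb connect0.
Qed.

Lemma connect_open_mono w w' u v : cle w w' ->
  connect (open_rel w) u v -> connect (open_rel w') u v.
Proof.
move=> /cleP ww'; apply: connect_sub => x y /existsP[e /and3P[we xe ye]].
by apply: connect1; apply/existsP; exists e; rewrite ww' ?xe.
Qed.

Lemma cluster_step w b u v : u \in open_cluster w b -> open_rel w u v ->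
  v \in open_cluster w b.
Proof.
rewrite !inE => /existsP[x /andP[xb xu]] uv; apply/existsP; exists x.
by rewrite xb (connect_trans xu) ?connect1.
Qed.

Lemma cluster_sub w b c : ends b \subset c ->
  (forall u v, u \in c -> open_rel w u v -> v \in c) -> open_cluster w b \subset c.
Proof.
move=> bc stable; apply/subsetP => v; rewrite inE => /existsP[u /andP[ub]].
case/connectP => p wp ->; have uc := subsetP bc _ ub.
elim: p u uc {ub} wp => //= x p IH u uc /andP[ux xp].
by apply: IH xp; apply: stable ux.
Qed.

(** Exploring the cluster reads only bonds meeting [c]: those leaving [c] must be closed, and those
    inside must join [c] to [b] by themselves. This puts the cluster event in the form that the
    Markov property handles. *)
Lemma cluster_decomp w b c :
  (open_cluster w b == c) =
  closed_on (boundary_bonds c) w && (open_cluster (cut (inner_bonds c) w) b == c).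
Proof.
have cutw S : cle (cut S w) w.
  by apply/cleP => e; rewrite ffunE => /andP[].
apply/eqP/andP => [<-|[/forall_inP cl /eqP cc]].
  set C := open_cluster w b.
  have inC e u : w e -> u \in ends e -> u \in C -> e \in inner_bonds C.
    move=> we ue uC; rewrite inE; apply/subsetP => v ve.
    by apply: cluster_step uC _; apply/existsP; exists e; rewrite we ue.
  split.
    apply/forall_inP => e; rewrite !inE negb_or => /andP[eC nd].
    apply/negP => we; case/negP: nd; apply/pred0P => u /=.
    by apply/negP => /andP[ue uC]; have := inC _ _ we ue uC; rewrite inE (negbTE eC).
  apply/eqP/setP => v; rewrite /C ![in RHS]inE [in LHS]inE; apply: eq_existsb => u.
  case ub: (u \in ends b) => //=; apply/idP/idP; first exact: (connect_open_mono (cutw _)).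
  case/connectP => p wp ->; have uC : u \in C by exact: (subsetP (ends_cluster _ _)).
  elim: p u uC {ub} wp => //= x p IH u uC /andP[ux xp].
  apply: (@connect_trans _ _ x); last first.
    by apply: IH xp; apply: cluster_step ux.
  case/existsP: ux => e /and3P[we ue xe]; apply: connect1.
  by apply/existsP; exists e; rewrite ffunE we ue xe (inC _ _ we ue uC).
apply/eqP; rewrite eqEsubset; apply/andP; split.
  apply: cluster_sub; first by have := ends_cluster (cut (inner_bonds c) w) b; rewrite cc.
  move=> u v uc /existsP[e /and3P[we ue ve]].
  have : e \notin boundary_bonds c by apply/negP => /cl; rewrite we.
  rewrite !inE negbK => /orP[/subsetP -> //|/pred0P /(_ u)].
  by rewrite /= ue uc.
apply/subsetP => v vc; have : v \in open_cluster (cut (inner_bonds c) w) b by rewrite cc.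
rewrite !inE => /existsP[u /andP[ub uv]].
by apply/existsP; exists u; rewrite ub (connect_open_mono (cutw _) uv).
Qed.

Hypothesis P_ge0 : forall w, 0 <= P w.
Hypothesis P_fkg : forall w w', P w * P w' <= P (cjoin w w') * P (cmeet w w').
Hypothesis P_markov : forall c A B,
  determined (inner_bonds c) A -> determined (outer_bonds c) B ->
  let Y := closed_on (boundary_bonds c) in
  mass P (fun w => A w && B w && Y w) * mass P Y =
  mass P (fun w => A w && Y w) * mass P (fun w => B w && Y w).

Lemma determinedI S A B : determined S A -> determined S B ->
  determined S (fun w => A w && B w).
Proof. by move=> hA hB w w' ww' /andP[/(hA _ _ ww') -> /(hB _ _ ww') ->]. Qed.

Lemma determined_agree S S' s : S' \subset S -> determined S (fun w => agree S' w s).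
Proof.
move=> SS' w w' ww'; apply: agree_trans; rewrite agree_sym.
exact: agreeS ww'.
Qed.

Section Decoupling.
Variables (T : {set I}) (s : {ffun I -> bool}) (b : I) (c : {set W}) (G : pred {ffun I -> bool}).
Hypothesis G_det : determined (outer_bonds c) G.

Let lo w := agree T w s && ~~ w b.
Let hiC w := [&& agree T w s, w b & open_cluster w b == c].
Let Y := closed_on (boundary_bonds c).

(* The cluster is found by looking at bonds touching it only; its closed boundary
   then screens off the state of [b]. *)
Lemma cluster_markov :
  mass P (fun w => hiC w && G w) * mass P (fun w => lo w && Y w) =
  mass P hiC * mass P (fun w => lo w && Y w && G w).
Proof.
(* The cluster contains the ends of [b] and has a closed boundary, so [hiC] is empty unless [b] lies
   inside [c] and [s] is closed on the revealed boundary bonds. *)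
have [bc|nbc] := boolP (b \in inner_bonds c); last first.
  have e0 H : mass P (fun w => hiC w && H w) = 0.
    apply: big1 => w /andP[/and3P[_ _ /eqP cw] _].
    by case/negP: nbc; rewrite inE -cw ends_cluster.
  have := e0 xpredT; under eq_mass do rewrite andbT.
  by move=> ->; rewrite e0 !mul0r.
have [sY|nsY] := boolP (closed_on (T :&: boundary_bonds c) s); last first.
  have e0 H : mass P (fun w => hiC w && H w) = 0.
    apply: big1 => w /andP[/and3P[/agreeP ws _]]; rewrite cluster_decomp.
    case/andP=> /forall_inP cl _ _; case/negP: nsY; apply/forall_inP => e.
    by rewrite inE => /andP[eT /cl]; rewrite ws.
  have := e0 xpredT; under eq_mass do rewrite andbT.
  by move=> ->; rewrite e0 !mul0r.
pose B w := agree (T :&: outer_bonds c) w s.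
pose A1 w := [&& agree (T :&: inner_bonds c) w s, w b &
  open_cluster (cut (inner_bonds c) w) b == c].
pose A0 w := agree (T :&: inner_bonds c) w s && ~~ w b.
(* Given a closed boundary, agreement with the revealed states amounts to separate conditions inside
   and outside [c]. *)
have split w : Y w -> agree T w s = agree (T :&: inner_bonds c) w s && B w.
  move=> /forall_inP Yw; apply/agreeP/andP => [h|[/agreeP h1 /agreeP h2] e eT].
    by split; apply/agreeP => e; rewrite inE => /andP[/h].
  have [ei|ei] := boolP (e \in inner_bonds c); first by apply: h1; rewrite inE eT.
  have [eo|eo] := boolP (e \in outer_bonds c); first by apply: h2; rewrite inE eT.
  have eY : e \in boundary_bonds c by rewrite !inE in ei eo *; rewrite negb_or ei.
  rewrite (negbTE (Yw _ eY)); apply/esym/negbTE.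
  by move/forall_inP: sY; apply; rewrite inE eT.
have eq1 H : mass P (fun w => hiC w && H w) = mass P (fun w => A1 w && (B w && H w) && Y w).
  apply: eq_mass => w; rewrite /hiC /A1 cluster_decomp -/Y.
  case Yw: (Y w) => //=; last by rewrite !andbF.
  rewrite split // andbT; case: (agree _ w s); case: (B w); case: (w b); case: (_ == c);
  by case: (H w).
have eq0 H : mass P (fun w => lo w && Y w && H w) = mass P (fun w => A0 w && (B w && H w) && Y w).
  apply: eq_mass => w; rewrite /lo /A0.
  case Yw: (Y w) => //=; last by rewrite !andbF.
  by rewrite split // !andbT; case: (agree _ w s); case: (B w); case: (w b); case: (H w).
have eq1' : mass P hiC = mass P (fun w => A1 w && B w && Y w).
  have := eq1 xpredT; under eq_mass do rewrite andbT; move=> ->.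
  by apply: eq_mass => w; rewrite andbT.
have eq0' : mass P (fun w => lo w && Y w) = mass P (fun w => A0 w && B w && Y w).
  have := eq0 xpredT; under eq_mass do rewrite andbT; move=> ->.
  by apply: eq_mass => w; rewrite andbT.
rewrite eq1 eq1' eq0 eq0'.
have dB : determined (outer_bonds c) B by apply: determined_agree; apply: subsetIr.
have dBG := determinedI dB G_det.
have db j : determined (inner_bonds c) (fun w => w b == j).
  by move=> w w' /agreeP h; rewrite h.
have dT : determined (inner_bonds c) (fun w => agree (T :&: inner_bonds c) w s).
  by apply: determined_agree; apply: subsetIr.
have dA0 : determined (inner_bonds c) A0.
  move=> w w' ww' /andP[h1 h2]; rewrite /A0 (dT _ _ ww' h1).
  by have := db false _ _ ww'; rewrite !eqbF_neg => ->.
have dA1 : determined (inner_bonds c) A1.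
  move=> w w' ww' /and3P[h1 h2 h3]; rewrite /A1 (dT _ _ ww' h1).
  have := db true _ _ ww'; rewrite !eqb_id => -> //=.
  suff <- : cut (inner_bonds c) w = cut (inner_bonds c) w' by [].
  apply/ffunP => e; rewrite !ffunE; case ei: (e \in inner_bonds c) => //=.
  exact: (agreeP _ _ _ ww').
have [y0|y0] := eqVneq (mass P Y) 0.
  have z A : mass P (fun w => A w && Y w) = 0.
    apply/eqP; rewrite eq_le mass_ge0 // andbT -y0; apply: mass_sub => // w.
    by case/andP.
  by rewrite !z !mul0r.
have m1 := P_markov dA1 dB; have m1g := P_markov dA1 dBG.
have m0 := P_markov dA0 dB; have m0g := P_markov dA0 dBG.
rewrite -/Y in m1 m1g m0 m0g.
(* Each of the four masses, multiplied by [mass P Y], factors into an inner and an outer part; after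
   two such multiplications the sides coincide. *)
apply: (mulIf y0); apply: (mulIf y0).
set x := mass P _; set y := mass P _; set u := mass P _; set v := mass P _.
rewrite -/x in m1g; rewrite -/y in m0; rewrite -/u in m1; rewrite -/v in m0g.
have swap (p q z : R) : p * q * z * z = (p * z) * (q * z) by ring.
by rewrite !swap m1g m0 m1 m0g; ring.
Qed.

Lemma lo_lattice w w' : lo w && Y w -> lo w' ->
  lo (cjoin w w') && (lo (cmeet w w') && Y (cmeet w w')).
Proof.
case/andP=> /andP[ws wb] /forall_inP wY /andP[ws' wb'].
have [js ms] := agree_joinmeet ws ws'.
have ss : cjoin s s = s by apply/ffunP => e; rewrite ffunE orbb.
have ss' : cmeet s s = s by apply/ffunP => e; rewrite ffunE andbb.
rewrite ss in js; rewrite ss' in ms.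
rewrite /lo js ms !ffunE (negbTE wb) (negbTE wb') /=.
by apply/forall_inP => e /wY; rewrite ffunE => /negbTE ->.
Qed.

(** The meet of a configuration in [hiC] with one in [lo] lies in [lo] and is closed on the
    boundary. By the four functions theorem [hiC] and [lo] cannot both have positive mass when that
    event is null. *)
Lemma lo_closed_eq0 : mass P (fun w => lo w && Y w) = 0 -> mass P hiC * mass P lo = 0.
Proof.
move=> z; apply/eqP; rewrite eq_le andbC mulr_ge0 ?mass_ge0 //=.
have := @four_functions _ _ (fun w => if hiC w then P w else 0)
  (fun w => if lo w then P w else 0) P (fun w => if lo w && Y w then P w else 0).
rewrite -!big_mkcond -!/(mass _ _) z mulr0; apply => [w|w|//|w|u v];
  do ?by case: ifP.
case: ifP => hu; last by rewrite mul0r mulr_ge0 //; case: ifP.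
case: ifP => hv; last by rewrite mulr0 mulr_ge0 //; case: ifP.
have -> : lo (cmeet u v) && Y (cmeet u v); last exact: P_fkg.
move: hu hv => /and3P[us ub]; rewrite cluster_decomp => /andP[/forall_inP uY _].
case/andP => vs vb; have [_] := agree_joinmeet us vs.
have -> : cmeet s s = s by apply/ffunP => e; rewrite ffunE andbb.
rewrite /lo => -> /=; rewrite ffunE (negbTE vb) andbF /=.
by apply/forall_inP => e /uY; rewrite ffunE => /negbTE ->.
Qed.

(** By [cluster_markov] the probability of [G] given [hiC] equals the one given [lo] with closed
    boundary, and closing bonds lowers the probability of an increasing event. *)
Lemma cluster_decouple_up : up_closed G ->
  mass P (fun w => hiC w && G w) * mass P lo <= mass P hiC * mass P (fun w => lo w && G w).
Proof.
move=> Gup; have hC : mass P (fun w => hiC w && G w) <= mass P hiC.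
  by apply: mass_sub => // w /andP[].
have [z|nz] := eqVneq (mass P (fun w => lo w && Y w)) 0.
  rewrite (@le_trans _ _ (mass P hiC * mass P lo)) ?ler_wpM2r ?mass_ge0 //.
  by rewrite lo_closed_eq0 // mulr_ge0 ?mass_ge0.
have pos : 0 < mass P (fun w => lo w && Y w) by rewrite lt_def nz mass_ge0.
rewrite -(ler_pM2r pos) mulrAC cluster_markov -!mulrA ler_wpM2l ?mass_ge0 //.
rewrite (mass_indic (fun w => lo w && Y w) G) (mass_indic lo G).
apply: holley_up => // [u v|u v _ _].
- by move=> hu hv; apply: lo_lattice.
- by rewrite ler_nat; case: (G u) (Gup _ _ (cle_joinl u v)) => // ->.
Qed.

Lemma cluster_decouple_down : down_closed G ->
  mass P hiC * mass P (fun w => lo w && G w) <= mass P (fun w => hiC w && G w) * mass P lo.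
Proof.
move=> Gdn.
have [z|nz] := eqVneq (mass P (fun w => lo w && Y w)) 0.
  rewrite (@le_trans _ _ (mass P hiC * mass P lo)) ?ler_wpM2l ?mass_ge0 //.
    by apply: mass_sub => // w /andP[].
  by rewrite lo_closed_eq0 // mulr_ge0 ?mass_ge0.
have pos : 0 < mass P (fun w => lo w && Y w) by rewrite lt_def nz mass_ge0.
rewrite -(ler_pM2r pos) [leRHS]mulrAC cluster_markov -!mulrA ler_wpM2l ?mass_ge0 //.
rewrite (mass_indic (fun w => lo w && Y w) G) (mass_indic lo G).
apply: holley_down => // [u v|u v _ _].
- by move=> hu hv; apply: lo_lattice.
- by rewrite ler_nat; case: (G v) (Gdn _ _ (cle_meetr u v)) => // ->.
Qed.

End Decoupling.

End Clusters.

(** * Mixing at good sites *)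

Section Mixing.
Context {R : realFieldType} {I W K : finType} {ends : I -> {set W}}.
Context {P : {ffun I -> bool} -> R} {N : K -> {set I}}.
Context {J : K -> pred {ffun I -> bool}} {delta : R}.
Implicit Types (s t w : {ffun I -> bool}) (T S H : {set I}) (e b : I) (k : K).
Implicit Types (i j : bool).

Local Notation open_cluster := (@open_cluster I W ends).
Local Notation outer_bonds := (@outer_bonds I W ends).

Hypothesis P_ge0 : forall w, 0 <= P w.
Hypothesis P_fkg : forall w w', P w * P w' <= P (cjoin w w') * P (cmeet w w').
Hypothesis P_markov : forall c A B,
  determined (inner_bonds (ends := ends) c) A -> determined (outer_bonds c) B ->
  let Y := closed_on (boundary_bonds (ends := ends) c) in
  mass P (fun w => A w && B w && Y w) * mass P Y =
  mass P (fun w => A w && Y w) * mass P (fun w => B w && Y w).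
Hypothesis J_up : forall k, up_closed (J k).
Hypothesis delta_gt0 : 0 < delta.

Local Notation ones := [ffun=> true].
Hypothesis P_ones : 0 < P ones.
Hypothesis J_wired : forall k,
  mass P (fun w => agree (~: N k) w ones && J k w) <=
  delta ^+ 2 * mass P ((agree (~: N k))^~ ones).

(* Once [T] is revealed, [J k] is unlikely whatever happens off [N k]; quantifying
   over a larger configuration [t] avoids conditioning on null events. *)
Definition good T s k : bool :=
  [exists t, [&& agree (~: N k) t ones, [forall e in T :&: N k, s e ==> t e],
    0 < P t & mass P (fun w => agree (T :|: ~: N k) w t && J k w) <=
              delta * mass P ((agree (T :|: ~: N k))^~ t)]].

(** The configuration [t] provided by goodness dominates [w] on all the bonds conditioned upon,
    being open off [N k]; since [J k] is increasing, Holley's inequality carries the bound from [t]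
    to [w]. *)
Lemma good_use T s k w : good T s k -> agree T w s ->
  mass P (fun u => agree (T :|: ~: N k) u w && J k u) <=
  delta * mass P ((agree (T :|: ~: N k))^~ w).
Proof.
case/existsP => t /and4P[tN /forall_inP st Pt tJ] ws; set S := T :|: ~: N k.
have wt : {in S, forall e, w e -> t e}.
  move=> e eS we; have [eN|eN] := boolP (e \in N k); last first.
    by rewrite (agreeP _ _ _ tN) ?inE ?eN // ffunE.
  have eT : e \in T by move: eS; rewrite !inE eN orbF.
  have /implyP ste : s e ==> t e by apply: st; rewrite inE eT.
  by apply: ste; rewrite -(agreeP _ _ _ ws).
have pos : 0 < mass P ((agree S)^~ t) by apply: mass_gt0 Pt; rewrite ?agree_refl.
rewrite -(ler_pM2r pos); apply: (@le_trans _ _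
    (mass P (fun u => agree S u t && J k u) * mass P ((agree S)^~ w))).
  rewrite !(mass_indic _ (J k)); apply: holley_up => // u v.
    move=> /agreeP uw /agreeP vt; apply/andP; split; apply/agreeP => e eS.
      by rewrite ffunE uw // vt //; case: (w e) (wt _ eS) => //= ->.
    by rewrite ffunE uw // vt //; case: (w e) (wt _ eS) => //= ->.
  move=> _ _; rewrite ler_nat; case: (J k u) (@J_up k _ _ (cle_joinl u v)) => //.
  by move=> ->.
by rewrite mulrAC ler_wpM2r ?mass_ge0.
Qed.

Lemma good_anti T s t k : cle s t -> good T t k -> good T s k.
Proof.
move=> /cleP st /existsP[u /and4P[h1 /forall_inP h2 h3 h4]].
apply/existsP; exists u; rewrite h1 h3 h4 !andbT.
by apply/forall_inP => e eT; apply/implyP => /st; apply/implyP/h2.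
Qed.

Lemma good_agree T s t k : agree T s t -> good T s k = good T t k.
Proof.
move=> /agreeP st; apply: eq_existsb => u; congr (_ && (_ && _)).
apply: eq_forallb => e; rewrite !inE; case eT: (e \in T) => //=.
by rewrite st.
Qed.

(** In the wired measure, Markov's inequality turns the bound [delta ^+ 2] on [J k] into a bound
    [delta] on badness. Badness is increasing by [good_anti], hence most likely with open bonds off
    [N k], and the bound persists for every state [s] there. *)
Lemma good_rare T s k :
  mass P (fun w => agree (~: N k) w s && ~~ good T w k) <=
  delta * mass P ((agree (~: N k))^~ s).
Proof.
have pos : 0 < mass P ((agree (~: N k))^~ ones).
  by apply: mass_gt0 P_ones; rewrite ?agree_refl.
have rare1 : delta * mass P (fun w => agree (~: N k) w ones && ~~ good T w k) <=
    delta ^+ 2 * mass P ((agree (~: N k))^~ ones).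
  apply: le_trans (J_wired k).
  apply: (@le_trans _ _ (mass P
     (fun w => agree (~: N k) w ones && ~~ good T w k && J k w))); last first.
    by apply: mass_sub => // w /andP[/andP[-> _] ->].
  apply: (@mass_class_ge _ _ _ P_ge0 (T :|: ~: N k)) => [w w'|w /andP[wN nG] Pw].
    rewrite agreeU => /andP[wT wN] /andP[h g].
    by rewrite -(good_agree _ wT) g andbT; apply: agree_trans h; rewrite agree_sym.
  (* Were [J k] less likely than [delta] in the class of [w], then [w] itself would witness
     goodness. *)
  rewrite leNgt; apply/negP => lt; case/negP: nG; apply/existsP; exists w.
  by apply/and4P; split=> //; [apply/forall_inP => e _; apply: implybb | exact: ltW].
have rare : mass P (fun w => agree (~: N k) w ones && ~~ good T w k) <=
    delta * mass P ((agree (~: N k))^~ ones).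
  by rewrite -(ler_pM2l delta_gt0) mulrA -expr2.
rewrite -(ler_pM2r pos); apply: (@le_trans _ _
    (mass P (fun w => agree (~: N k) w ones && ~~ good T w k) *
     mass P ((agree (~: N k))^~ s))); last first.
  by rewrite mulrAC ler_wpM2r ?mass_ge0.
rewrite (mass_indic _ (fun w => ~~ good T w k)).
rewrite [X in _ <= X * _](mass_indic _ (fun w => ~~ good T w k)).
apply: holley_up => // u v.
  move=> /agreeP us /agreeP v1; apply/andP; split; apply/agreeP => e eN.
    by rewrite !ffunE v1 // ffunE orbT.
  by rewrite !ffunE us // v1 // ffunE andbT.
move=> _ _; rewrite ler_nat; have := @good_anti T _ _ k (cle_joinl u v).
by case: (good T (cjoin u v) k) => [-> //|_]; apply: leq_b1.
Qed.

Definition constant_on i H w := [forall e in H, w e == i].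

Lemma constant_on_determined i H S : H \subset S -> determined S (constant_on i H).
Proof.
move=> /subsetP HS w w' /agreeP ww' /forall_inP h; apply/forall_inP => e eH.
by rewrite -ww' ?HS // h.
Qed.

Lemma constant_on_up H : up_closed (constant_on true H).
Proof.
move=> w w' /cleP ww' /forall_inP h; apply/forall_inP => e /h.
by rewrite !eqb_id => /ww'.
Qed.

Lemma constant_on_down H : down_closed (constant_on false H).
Proof.
move=> w w' /cleP ww' /forall_inP h; apply/forall_inP => e /h.
by rewrite !eqbF_neg; apply/contra/ww'.
Qed.

Lemma mass_partition (C : finType) (f : {ffun I -> bool} -> C) (G : pred {ffun I -> bool}) :
  mass P G = \sum_c mass P (fun w => G w && (f w == c)).
Proof. exact: partition_big. Qed.

Section Node.
Variables (T : {set I}) (s : {ffun I -> bool}) (b : I) (HH : pred {set I}).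
Hypothesis separated : forall H w, HH H -> ~~ (H \subset outer_bonds (open_cluster w b)) ->
  exists k, [/\ b \notin N k, good T s k, [disjoint H & N k] & J k w].

Let c j w := agree T w s && (w b == j).
Let G i w := [exists H, HH H && constant_on i H w].

(** Neither [b] nor [F] looks inside [N k], so conditioning on them only selects classes of
    agreement on [T :|: ~: N k], in each of which [good_use] applies. *)
Lemma good_node k j S (F : pred {ffun I -> bool}) : b \notin N k -> good T s k ->
  [disjoint S & N k] -> determined S F ->
  mass P (fun w => c j w && F w && J k w) <= delta * mass P (fun w => c j w && F w).
Proof.
move=> bN gk SN dF; apply: (@mass_class_le _ _ _ P_ge0 (T :|: ~: N k)).
  move=> w w'; rewrite agreeU => /andP[wT wN] /andP[/andP[ws wb] Fw].
  rewrite /c -(agreeP _ _ _ wN) ?inE // wb (agree_trans _ ws) 1?agree_sym //=.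
  apply: dF Fw; apply: agreeS wN; apply/subsetP => e eS.
  by rewrite inE (disjointFr SN eS).
by move=> w /andP[/andP[ws _] _]; apply: good_use ws.
Qed.

(** Where the open set [H] avoids the cluster of [b], [cluster_decouple_up] is summed over clusters.
    Otherwise some [J k] occurs with [N k] away from [b] and [H], and a union bound over [k] makes
    this at most a fraction [#|K| delta] of the event. *)
Lemma mixing_open :
  (1 - #|K|%:R * delta) * mass P (fun w => c true w && G true w) * mass P (c false) <=
  mass P (fun w => c false w && G true w) * mass P (c true).
Proof.
pose U0 w := [exists H, [&& HH H, constant_on true H w & H \subset outer_bonds (open_cluster w b)]].
have A1 : mass P (fun w => c true w && G true w && ~~ U0 w) <=
    #|K|%:R * (delta * mass P (fun w => c true w && G true w)).
  pose Gk k w := [exists H, [&& HH H, [disjoint H & N k] & constant_on true H w]].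
  apply: (@le_trans _ _ (\sum_k mass P (fun w => (b \notin N k) && good T s k &&
      (c true w && Gk k w && J k w)))).
    apply: mass_union_le => // w /andP[/andP[cw /existsP[H /andP[HHH Hw]]] nU].
    have [|k [bN gk HN Jk]] := separated (H := H) (w := w) HHH.
      by apply: contra nU => ho; apply/existsP; exists H; rewrite HHH Hw.
    by exists k; rewrite bN gk cw Jk /= andbT; apply/existsP; exists H; rewrite HHH HN.
  rewrite mulr_natl -sumr_const; apply: ler_sum => k _.
  have [/andP[bN gk]|nb] := boolP ((b \notin N k) && good T s k); last first.
    rewrite [X in X <= _]big1 => [|w]; last by rewrite ?(negbTE nb).
    by rewrite mulr_ge0 ?mass_ge0 // ltW.
  apply: (@le_trans _ _ (delta * mass P (fun w => c true w && Gk k w))).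
    rewrite /=; apply: (@good_node k true (~: N k)) => //.
      by rewrite disjoints_subset.
    move=> w w' /agreeP ww'; rewrite /Gk => /existsP[H /and3P[h1 h2 h3]]; apply/existsP; exists H.
    rewrite h1 h2 (constant_on_determined (S := ~: N k) _ _ h3) //.
      by rewrite -disjoints_subset.
    exact/agreeP.
  rewrite ler_wpM2l ?(ltW delta_gt0) //; apply: mass_sub => // w.
  by case/andP=> -> /existsP[H /and3P[h1 _ h3]]; apply/existsP; exists H; rewrite h1.
have A2 : mass P (fun w => c true w && G true w && U0 w) * mass P (c false) <=
    mass P (fun w => c false w && G true w) * mass P (c true).
  rewrite (mass_partition (fun w => open_cluster w b)).
  rewrite [mass P (c true)](mass_partition (fun w => open_cluster w b)).
  rewrite mulr_suml mulr_sumr; apply: ler_sum => C _; rewrite [leRHS]mulrC.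
  pose GC w := [exists H, [&& HH H, H \subset outer_bonds C & constant_on true H w]].
  have dG : determined (outer_bonds C) GC.
    move=> w w' ww' /existsP[H /and3P[h1 h2 h3]]; apply/existsP; exists H.
    by rewrite h1 h2 (constant_on_determined h2 ww').
  have uG : up_closed GC.
    move=> w w' ww' /existsP[H /and3P[h1 h2 h3]]; apply/existsP; exists H.
    by rewrite h1 h2 (constant_on_up ww').
  have := cluster_decouple_up P_ge0 P_fkg P_markov T s b dG uG.
  set h := fun w => [&& agree T w s, w b & open_cluster w b == C].
  set l := fun w => agree T w s && ~~ w b.
  rewrite (eq_mass (H := c false) (G := l)); last by move=> w; rewrite /c eqbF_neg.
  rewrite (eq_mass (H := fun w => c true w && (open_cluster w b == C)) (G := h)); last first.
    by move=> w; rewrite /c /h eqb_id -andbA.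
  move=> le; apply: (le_trans _ (le_trans le _)).
    rewrite ler_wpM2r ?mass_ge0 //; apply: mass_sub => // w.
    case/andP=> /andP[/andP[/andP[ws wb] _] /existsP[H /and3P[h1 h2 h3]]] /eqP wC.
    rewrite ws wC eqxx -(eqb_id (w b)) wb; apply/existsP; exists H.
    by rewrite h1 h2 -wC h3.
  rewrite ler_wpM2l ?mass_ge0 //; apply: mass_sub => // w /andP[/andP[ws wb]].
  case/existsP => H /and3P[h1 h2 h3]; rewrite /c ws eqbF_neg wb; apply/existsP.
  by exists H; rewrite h1.
have := massID (P := P) (fun w => c true w && G true w) U0.
set x := mass P _ in A1 * => xE; set u := mass P _ in A2 xE.
apply: le_trans A2; rewrite ler_wpM2r ?mass_ge0 //.
by rewrite mulrBl mul1r -mulrA; lra.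
Qed.

(** Now the law with [b] open, whose cluster is explored, is the one to be bounded from below. So
    every member of [HH] is required to avoid the cluster, and the exceptional part is measured
    against [c true] alone. *)
Lemma mixing_closed :
  (1 - #|K|%:R * delta) * mass P (fun w => c false w && G false w) * mass P (c true) <=
  mass P (fun w => c true w && G false w) * mass P (c false).
Proof.
pose clean C := [forall H, HH H ==> (H \subset outer_bonds C)].
have A1 : mass P (fun w => c true w && ~~ clean (open_cluster w b)) <=
    #|K|%:R * (delta * mass P (c true)).
  apply: (@le_trans _ _ (\sum_k mass P (fun w => (b \notin N k) && good T s k &&
      (c true w && J k w)))).
    apply: mass_union_le => // w /andP[cw /forallPn[H]].
    rewrite negb_imply => /andP[HHH ho].
    by have [k [bN gk HN Jk]] := separated HHH ho; exists k; rewrite bN gk cw Jk.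
  rewrite mulr_natl -sumr_const; apply: ler_sum => k _.
  have [/andP[bN gk]|nb] := boolP ((b \notin N k) && good T s k); last first.
    rewrite [X in X <= _]big1 => [|w]; last by rewrite ?(negbTE nb).
    by rewrite mulr_ge0 ?mass_ge0 // ltW.
  have d0 : [disjoint set0 & N k] by rewrite disjoints_subset sub0set.
  have := @good_node k true set0 xpredT bN gk d0 (fun _ _ _ _ => isT).
  move=> le; apply: (le_trans _ (le_trans le _)).
    by apply: mass_sub => // w; rewrite andbT.
  by rewrite ler_wpM2l ?(ltW delta_gt0) //; apply: mass_sub => // w /andP[].
have A2 : mass P (fun w => c true w && clean (open_cluster w b)) *
    mass P (fun w => c false w && G false w) <=
    mass P (fun w => c true w && G false w) * mass P (c false).
  rewrite (mass_partition (fun w => open_cluster w b)).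
  rewrite [mass P (fun w => c true w && _)](mass_partition (fun w => open_cluster w b)).
  rewrite !mulr_suml; apply: ler_sum => C _.
  have [cC|nC] := boolP (clean C); last first.
    rewrite [X in X * _]big1 ?mul0r ?mulr_ge0 ?mass_ge0 // => w.
    by case/andP=> /andP[_ cw] /eqP wC; case/negP: nC; rewrite -wC.
  have dG : determined (outer_bonds C) (G false).
    move=> w w' ww' /existsP[H /andP[h1 h2]]; apply/existsP; exists H.
    by rewrite h1 (constant_on_determined (implyP (forallP cC H) h1) ww').
  have uG : down_closed (G false).
    move=> w w' ww' /existsP[H /andP[h1 h2]]; apply/existsP; exists H.
    by rewrite h1 (constant_on_down ww').
  have := cluster_decouple_down P_ge0 P_fkg P_markov T s b dG uG.
  set h := fun w => [&& agree T w s, w b & open_cluster w b == C].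
  set l := fun w => agree T w s && ~~ w b.
  rewrite (eq_mass (H := c false) (G := l)); last by move=> w; rewrite /c eqbF_neg.
  move=> le; apply: (le_trans _ (le_trans le _)).
    apply: ler_pM; rewrite ?mass_ge0 //; apply: mass_sub => // w.
      by case/andP=> /andP[/andP[ws wb] _] wC; rewrite /h ws wC -(eqb_id (w b)) wb.
    by case/andP=> /andP[ws wb] ->; rewrite /l ws -eqbF_neg wb.
  rewrite ler_wpM2r ?mass_ge0 //; apply: mass_sub => // w.
  by case/andP=> /and3P[ws wb wC] ->; rewrite /c ws wb wC.
have := massID (P := P) (c true) (fun w => clean (open_cluster w b)).
set x := mass P _ in A1 * => xE; set u := mass P _ in A2 xE.
apply: le_trans A2; rewrite mulrAC ler_wpM2r ?mass_ge0 //.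
by rewrite mulrBl mul1r -mulrA; lra.
Qed.

Lemma mixing i :
  (1 - #|K|%:R * delta) * mass P (fun w => c i w && G i w) * mass P (c (~~ i)) <=
  mass P (fun w => c (~~ i) w && G i w) * mass P (c i).
Proof. by case: i; [exact: mixing_open | exact: mixing_closed]. Qed.

End Node.

End Mixing.

(** * Decoupling two copies *)

Section Decoupling.
Context {R : realFieldType} {I W K : finType} {ends : I -> {set W}}.
Context {P : {ffun I -> bool} -> R} {N : K -> {set I}}.
Context {J : K -> pred {ffun I -> bool}} {delta : R}.
Implicit Types (s t w : {ffun I -> bool}) (T S H : {set I}) (e b : I) (k : K).
Implicit Types (EF : {set I} * {set I}) (TT : pred ({set I} * {set I})).
Implicit Types (C D : pred {ffun I -> bool}).

Local Notation open_cluster := (@open_cluster I W ends).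
Local Notation outer_bonds := (@outer_bonds I W ends).
Local Notation ones := [ffun=> true].

Hypothesis P_ge0 : forall w, 0 <= P w.
Hypothesis P_fkg : forall w w', P w * P w' <= P (cjoin w w') * P (cmeet w w').
Hypothesis P_markov : forall c A B,
  determined (inner_bonds (ends := ends) c) A -> determined (outer_bonds c) B ->
  let Y := closed_on (boundary_bonds (ends := ends) c) in
  mass P (fun w => A w && B w && Y w) * mass P Y =
  mass P (fun w => A w && Y w) * mass P (fun w => B w && Y w).
Hypothesis J_up : forall k, up_closed (J k).
Hypothesis delta_gt0 : 0 < delta.
Hypothesis P_ones : 0 < P ones.
Hypothesis J_wired : forall k,
  mass P (fun w => agree (~: N k) w ones && J k w) <=
  delta ^+ 2 * mass P ((agree (~: N k))^~ ones).
Hypothesis delta_small : #|K|%:R * delta <= 1.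

Local Notation good := (good (P := P) (N := N) (J := J) (delta := delta)).
Local Notation kappa := (1 - #|K|%:R * delta).

Variable i : bool.

Definition clear EF k := [disjoint EF.1 :|: EF.2 & N k].

(* Any influence of [b] on [H] has to pass through some [N k] that meets neither
   witness, whatever the configuration. *)
Definition separates EF b H :=
  [forall w, ~~ (H \subset outer_bonds (open_cluster w b)) ==>
     [exists k, [&& b \notin N k, clear EF k & J k w]]].

Definition separated_from EF b := separates EF b EF.2 || separates EF b EF.1.

(** The witnesses are sought in different copies. For the family of witness pairs of two events, the
    diagonal mass bounds the disjoint occurrence and the mass over independent copies is bounded by
    the product. *)
Definition theta TT w w' := [exists EF, [&& TT EF, constant_on i EF.1 w & constant_on i EF.2 w']].

Definition pairmass C D TT : R :=
  \sum_(w | C w) \sum_(w' | D w') P w * P w' * (theta TT w w')%:R.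

Definition goodall T s EF := [forall k, clear EF k ==> good T s k].

Lemma pairmass_ge0 C D TT : 0 <= pairmass C D TT.
Proof. by do 2![apply: sumr_ge0 => ? _]; rewrite !mulr_ge0. Qed.

Lemma pairmass_sub C D TT TT' : (forall EF, TT EF -> TT' EF) ->
  pairmass C D TT <= pairmass C D TT'.
Proof.
move=> sub; do 2![apply: ler_sum => ? _]; rewrite ler_wpM2l ?mulr_ge0 // ler_nat.
case tE: (theta TT _ _) => //; rewrite lt0b.
case/existsP: tE => EF /and3P[/sub h1 h2 h3].
by apply/existsP; exists EF; rewrite h1 h2 h3.
Qed.

Section Step.
Variables (T : {set I}) (s : {ffun I -> bool}) (b : I) (TT : pred ({set I} * {set I})).
Hypothesis TT_sep : forall EF, TT EF -> separated_from EF b.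

Let c (j : bool) w := agree T w s && (w b == j).
Let C w := agree T w s.
Let TTg EF := TT EF && goodall T s EF.
Let Z j := mass P (c j).
Let mu j w : R := (c j w)%:R * P w / Z j.
Local Notation E2 j k F :=
  (expect (mu j) (fun s => expect (mu k) (fun t => (F s t : bool)%:R))).

(** [U] collects the pairs whose second witness is out of reach of [b], and [V] those whose first
    witness is; the copy carrying that witness can have its law changed. *)
Let U u v := [exists EF, [&& TTg EF, separates EF b EF.2,
  constant_on i EF.1 u & constant_on i EF.2 v]].
Let V u v := [exists EF, [&& TTg EF, separates EF b EF.1,
  constant_on i EF.1 u & constant_on i EF.2 v]].

Lemma expect_mu j f : expect (mu j) f = (\sum_(w | c j w) f w * P w) / Z j.
Proof.
rewrite /expect /mu mulr_suml [RHS]big_mkcond; apply: eq_bigr => w _.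
by case: (c j w); rewrite ?mul1r ?mulrA // mulr0n mulr0 !mul0r.
Qed.

Lemma node_lattice u v : c false u -> c true v ->
  c true (cjoin u v) && c false (cmeet u v).
Proof.
case/andP=> us /eqP ub /andP[vs /eqP vb]; have [] := agree_joinmeet us vs.
have -> : cjoin s s = s by apply/ffunP => e; rewrite ffunE orbb.
have -> : cmeet s s = s by apply/ffunP => e; rewrite ffunE andbb.
by rewrite /c => -> ->; rewrite !ffunE ub vb.
Qed.

(** Reversing the order for [i = false] makes [constant_on i] increasing and puts the law with [b]
    in state [i] on top in both cases. *)
Let le (u v : {ffun I -> bool}) := if i then cle u v else cle v u.

Lemma constant_on_le H u v : le u v -> constant_on i H u -> constant_on i H v.
Proof. by rewrite /le; case: i => h; [apply: constant_on_up h | apply: constant_on_down h]. Qed.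

Hypothesis Z_gt0 : forall j, 0 < Z j.

Lemma mu_ge0 j w : 0 <= mu j w.
Proof. by rewrite /mu divr_ge0 ?mulr_ge0 ?(ltW (Z_gt0 j)). Qed.

Lemma cross_node f g : (forall w, 0 <= g w) -> (forall u v, le u v -> f u <= g v) ->
  expect (mu (~~ i)) f <= expect (mu i) g.
Proof.
move=> g0 fg; rewrite !expect_mu ler_pdivrMr // mulrAC ler_pdivlMr //.
move: fg; rewrite /le; case: i => fg.
- by apply: cross_dom_up => // u v; [apply: node_lattice | move=> _ _; apply: fg].
- by apply: cross_dom_down => // u v; [apply: node_lattice | move=> _ _; apply: fg].
Qed.

Lemma mixing_node (HH : pred {set I}) :
  (forall H w, HH H -> ~~ (H \subset outer_bonds (open_cluster w b)) ->
    exists k, [/\ b \notin N k, good T s k, [disjoint H & N k] & J k w]) ->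
  kappa * expect (mu i) (fun w => [exists H, HH H && constant_on i H w]%:R) <=
  expect (mu (~~ i)) (fun w => [exists H, HH H && constant_on i H w]%:R).
Proof.
move=> sep; rewrite !expect_mu -!mass_indic mulrA ler_pdivrMr // mulrAC ler_pdivlMr //.
exact: mixing sep i.
Qed.

Lemma clear_good EF k : TTg EF -> clear EF k -> good T s k.
Proof. by case/andP=> _ /forallP /(_ k) /implyP. Qed.

Lemma step_node :
  kappa * (E2 i i (theta TTg) + E2 (~~ i) (~~ i) (theta TTg)) <=
  E2 i (~~ i) (theta TTg) + E2 (~~ i) i (theta TTg).
Proof.
have UV u v : theta TTg u v = U u v || V u v.
  apply/existsP/orP => [[EF /and3P[h1 h2 h3]]|[]/existsP[EF /and4P[h1 h2 h3 h4]]].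
  - have /orP[sF|sE] := TT_sep (proj1 (andP h1)).
      by left; apply/existsP; exists EF; rewrite h1 sF h2.
    by right; apply/existsP; exists EF; rewrite h1 sE h2.
  - by exists EF; rewrite h1 h3.
  - by exists EF; rewrite h1 h3.
have E j j' : E2 j j' (theta TTg) = E2 j j' (fun u v => U u v || V u v).
  by apply: eq_expect => u; apply: eq_expect => v; rewrite UV.
rewrite !E.
apply: (@decoupling_step _ _ (mu (~~ i)) (mu i) le); do ?exact: mu_ge0.
- exact: cross_node.
- move=> u v u' v' uu' vv' /existsP[EF /and4P[h1 h2 h3 h4]]; apply/existsP; exists EF.
  by rewrite h1 h2 (constant_on_le uu') ?(constant_on_le vv').
- move=> u v u' v' uu' vv' /existsP[EF /and4P[h1 h2 h3 h4]]; apply/existsP; exists EF.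
  by rewrite h1 h2 (constant_on_le uu') ?(constant_on_le vv').
- by move=> u; rewrite /le; case: i; apply/cleP.
- by rewrite subr_ge0 delta_small gerBl mulr_ge0 ?(ltW delta_gt0).
(* With the first copy fixed at [u], [HH] lists the possible second witnesses, and [mixing_node]
   compares the two laws of the second copy. *)
- move=> u; pose HH (H : {set I}) :=
    [exists E, [&& TTg (E, H), separates (E, H) b H & constant_on i E u]].
  have sep H w : HH H -> ~~ (H \subset outer_bonds (open_cluster w b)) ->
    exists k, [/\ b \notin N k, good T s k, [disjoint H & N k] & J k w].
    case/existsP=> E0 /and3P[h1 /forallP /(_ w) /implyP h2 h3] /h2.
    case/existsP=> k /and3P[bN cl Jk]; exists k; split=> //.
      exact: clear_good cl.
    by apply: disjointWl cl; apply: subsetUr.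
  have eqU v : U u v = [exists H, HH H && constant_on i H v].
    apply/existsP/existsP => [[[E0 F] /and4P[h1 h2 h3 h4]]|[F /andP[/existsP[E0]]]].
      by exists F; rewrite h4 andbT; apply/existsP; exists E0; rewrite h1 h2 h3.
    by case/and3P=> h1 h2 h3 h4; exists (E0, F); rewrite h1 h2 h3 h4.
  have eE nu : expect nu (fun v => (U u v)%:R) =
      expect nu (fun v => [exists H, HH H && constant_on i H v]%:R).
    by apply: eq_expect => v; rewrite eqU.
  by rewrite !eE; apply: mixing_node.
- move=> v; pose HH (H : {set I}) :=
    [exists F, [&& TTg (H, F), separates (H, F) b H & constant_on i F v]].
  have sep H w : HH H -> ~~ (H \subset outer_bonds (open_cluster w b)) ->
    exists k, [/\ b \notin N k, good T s k, [disjoint H & N k] & J k w].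
    case/existsP=> F /and3P[h1 /forallP /(_ w) /implyP h2 h3] /h2.
    case/existsP=> k /and3P[bN cl Jk]; exists k; split=> //.
      exact: clear_good cl.
    by apply: disjointWl cl; apply: subsetUl.
  have eqV u : V u v = [exists H, HH H && constant_on i H u].
    apply/existsP/existsP => [[[E0 F] /and4P[h1 h2 h3 h4]]|[E0 /andP[/existsP[F]]]].
      by exists E0; rewrite h3 andbT; apply/existsP; exists F; rewrite h1 h2 h4.
    by case/and3P=> h1 h2 h3 h4; exists (E0, F); rewrite h1 h2 h3 h4.
  have eE nu : expect nu (fun u => (V u v)%:R) =
      expect nu (fun u => [exists H, HH H && constant_on i H u]%:R).
    by apply: eq_expect => u; rewrite eqV.
  by rewrite !eE; apply: mixing_node.
Qed.

End Step.

Section StepMass.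
Variables (T : {set I}) (s : {ffun I -> bool}) (b : I) (TT : pred ({set I} * {set I})).
Hypothesis TT_sep : forall EF, TT EF -> separated_from EF b.

Let c (j : bool) w := agree T w s && (w b == j).
Let C w := agree T w s.
Let TTg EF := TT EF && goodall T s EF.

Lemma pairmass_node : pairmass C C TTg =
  pairmass (c true) (c true) TTg + pairmass (c false) (c false) TTg +
  (pairmass (c true) (c false) TTg + pairmass (c false) (c true) TTg).
Proof.
have split (F : {ffun I -> bool} -> R) :
    \sum_(w | C w) F w = \sum_(w | c true w) F w + \sum_(w | c false w) F w.
  rewrite (bigID (fun w : {ffun I -> bool} => w b)) /=; congr (_ + _).
    by apply: eq_bigl => w; rewrite /c eqb_id.
  by apply: eq_bigl => w; rewrite /c eqbF_neg.
rewrite /pairmass split.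
under eq_bigr do rewrite split; under [X in _ + X = _]eq_bigr do rewrite split.
by rewrite !big_split /=; ring.
Qed.

Lemma mass_node : mass P C = mass P (c true) + mass P (c false).
Proof.
rewrite (massID _ (fun w : {ffun I -> bool} => w b)) /c; congr (_ + _); apply: eq_mass => w.
  by rewrite eqb_id.
by rewrite eqbF_neg.
Qed.

(* Sharing the bond [b] instead of resampling it independently in the two copies. *)
Lemma step :
  kappa * (pairmass (c true) (c true) TTg / mass P (c true) +
           pairmass (c false) (c false) TTg / mass P (c false)) <=
  pairmass C C TT / mass P C.
Proof.
have k0 : 0 <= kappa by rewrite subr_ge0.
have k1 : kappa <= 1 by rewrite gerBl mulr_ge0 ?(ltW delta_gt0).
have sub : pairmass C C TTg <= pairmass C C TT.
  by apply: pairmass_sub => EF /andP[].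
apply: (@le_trans _ _ (pairmass C C TTg / mass P C)); last first.
  by rewrite ler_wpM2r // invr_ge0 mass_ge0.
have p0 j j' : 0 <= pairmass (c j) (c j') TTg by exact: pairmass_ge0.
(* If one state of [b] is null, its term is 0 by the default value of division and the other state
   carries the whole mass. *)
have degenerate j : mass P (c j) = 0 ->
  kappa * (pairmass (c j) (c j) TTg / mass P (c j) +
     pairmass (c (~~ j)) (c (~~ j)) TTg / mass P (c (~~ j))) <=
  pairmass C C TTg / mass P C.
  move=> z; have -> : mass P C = mass P (c (~~ j)).
    by rewrite mass_node; case: (j) z => /= ->; rewrite ?addr0 ?add0r.
  rewrite z invr0 mulr0 add0r mulrA ler_wpM2r ?invr_ge0 ?mass_ge0 //.
  rewrite (@le_trans _ _ (pairmass (c (~~ j)) (c (~~ j)) TTg)) ?ler_piMl //.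
  have := p0 true false; have := p0 false true; have := p0 j j.
  by rewrite pairmass_node; case: (j); rewrite /=; lra.
have [z1|n1] := eqVneq (mass P (c true)) 0; first exact: degenerate.
have [z0|n0] := eqVneq (mass P (c false)) 0;
  first by rewrite [X in _ * X <= _]addrC; apply: degenerate.
have Z_gt0 j : 0 < mass P (c j) by rewrite lt_def mass_ge0 // andbT; case: j.
have := step_node TT_sep Z_gt0; rewrite -/c -/TTg.
have E j j' : expect (fun w => (c j w)%:R * P w / mass P (c j))
     (fun u => expect (fun w => (c j' w)%:R * P w / mass P (c j'))
       (fun v => (theta TTg u v)%:R)) =
   pairmass (c j) (c j') TTg / (mass P (c j) * mass P (c j')).
  rewrite expect_mu [mass P (c j) * _]mulrC invfM mulrA; congr (_ / _).
  rewrite /pairmass mulr_suml; apply: eq_bigr => u _.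
  rewrite expect_mu -/c mulrAC; congr (_ / _).
  by rewrite mulr_suml; apply: eq_bigr => v _; ring.
rewrite !E pairmass_node mass_node.
have : forall j j', pairmass (c j) (c j') TTg =
    pairmass (c j) (c j') TTg / (mass P (c j) * mass P (c j')) *
    (mass P (c j) * mass P (c j')).
  by move=> j j'; rewrite divfK // mulf_neq0 // gt_eqF.
move: (Z_gt0 true) (Z_gt0 false); set Z1 := mass P (c true); set Z0 := mass P (c false).
move=> Z1_gt0 Z0_gt0 pE hyp.
have {hyp}: kappa * (pairmass (c true) (c true) TTg / (Z1 * Z1) +
     pairmass (c false) (c false) TTg / (Z0 * Z0)) <=
    pairmass (c true) (c false) TTg / (Z1 * Z0) +
    pairmass (c false) (c true) TTg / (Z0 * Z1).
  move: hyp; case: (i) => /= hyp; first exact: hyp.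
  by rewrite [X in _ * X <= _]addrC [leRHS]addrC; apply: hyp.
rewrite [in X in _ -> X](pE true true) [in X in _ -> X](pE true false).
rewrite [in X in _ -> X](pE false true) [in X in _ -> X](pE false false).
have e0 j j' : 0 <= pairmass (c j) (c j') TTg / (mass P (c j) * mass P (c j')).
  by apply: divr_ge0; [exact: pairmass_ge0 | apply: mulr_ge0; exact: mass_ge0].
move: (e0 true true) (e0 false false); rewrite -/Z1 -/Z0.
set e11 := _ / (Z1 * Z1); set e10 := _ / (Z1 * Z0).
set e01 := _ / (Z0 * Z1); set e00 := _ / (Z0 * Z0) => e11_ge0 e00_ge0 hyp.
clearbody e11 e10 e01 e00.
rewrite !mulrA !mulfK ?gt_eqF // ler_pdivlMr ?addr_gt0 //.
have Z1_ge0 := ltW Z1_gt0; have Z0_ge0 := ltW Z0_gt0.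
have h1 : kappa * (e11 * Z1 * Z1) <= e11 * Z1 * Z1.
  by rewrite ler_piMl ?mulr_ge0.
have h0 : kappa * (e00 * Z0 * Z0) <= e00 * Z0 * Z0.
  by rewrite ler_piMl ?mulr_ge0.
(* The equal-state blocks survive multiplication by [kappa <= 1], and the mixed blocks, of weight
   [Z1 * Z0], obey the node estimate. The lower bounds add up to [kappa] times
   [(Z1 + Z0) * (e11 * Z1 + e00 * Z0)]. *)
have hx : Z1 * Z0 * (kappa * (e11 + e00)) <= Z1 * Z0 * (e10 + e01).
  by rewrite ler_wpM2l ?mulr_ge0.
rewrite [leLHS](_ : _ = kappa * (e11 * Z1 * Z1) + kappa * (e00 * Z0 * Z0) +
  Z1 * Z0 * (kappa * (e11 + e00))); last by ring.
rewrite [leRHS](_ : _ = e11 * Z1 * Z1 + e00 * Z0 * Z0 + Z1 * Z0 * (e10 + e01));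
  last by ring.
exact: lerD (lerD h1 h0) hx.
Qed.

End StepMass.

(* Goodness is required of every prefix of the revelation [l], since each step
   of the induction only sees the bonds revealed so far. *)
Fixpoint allgood T (l : seq I) w EF :=
  if l is b :: l' then goodall T w EF && allgood (b |: T) l' w EF else true.

Definition diag TT w := theta TT w w.

Lemma pairmass_child T s b j TT : b \notin T ->
  pairmass (fun w => agree T w s && (w b == j)) (fun w => agree T w s && (w b == j)) TT =
  pairmass ((agree (b |: T))^~ (upd s b j)) ((agree (b |: T))^~ (upd s b j)) TT.
Proof.
move=> bT; have E w : agree T w s && (w b == j) = agree (b |: T) w (upd s b j).
  by rewrite agree_upd ?setU11 // setU1K.
rewrite /pairmass; under eq_bigl do rewrite E.
by apply: eq_bigr => w _; apply: eq_bigl => w'; rewrite E.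
Qed.

(** Induction along the revelation. Once the bonds of every second witness are revealed, they are
    common to both copies, and independence off [T] costs nothing. Going back by one bond replaces
    sharing with independence, by [step], for a factor [kappa]; only pairs good at the current node
    are passed down. *)
Lemma decoupling_revealed l T s TT : uniq l -> {in l, forall b, b \notin T} ->
  (forall EF, TT EF -> EF.2 \subset T :|: [set b in l]) ->
  (forall EF b, TT EF -> separated_from EF b) ->
  kappa ^+ size l * mass P (fun w => agree T w s &&
     [exists EF, [&& TT EF, constant_on i EF.1 w, constant_on i EF.2 w & allgood T l w EF]]) <=
  pairmass ((agree T)^~ s) ((agree T)^~ s) TT / mass P ((agree T)^~ s).
Proof.
have k0 : 0 <= kappa by rewrite subr_ge0.
elim: l T s TT => [|b l IH] T s TT /=.
  move=> _ _ TF _; rewrite expr0 mul1r.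
  have [z|nz] := eqVneq (mass P ((agree T)^~ s)) 0.
    rewrite z invr0 mulr0 -z; apply: mass_sub => // w; by case/andP.
  rewrite ler_pdivlMr; last by rewrite lt_def nz mass_ge0.
  rewrite {1}/mass big_mkcondr mulr_suml /=; apply: ler_sum => w ws.
  case: ifP => [/existsP[EF /and4P[h1 h2 h3 _]]|_]; last first.
    by rewrite mul0r sumr_ge0 // => w' _; rewrite !mulr_ge0.
  rewrite mulr_sumr; apply: ler_sum => w' w's.
  have -> : theta TT w w'; last by rewrite mulr1.
  apply/existsP; exists EF; rewrite h1 h2; apply/forall_inP => e eF.
  have eT : e \in T by have := subsetP (TF _ h1) _ eF; rewrite !inE orbF.
  by rewrite (agreeP _ _ _ w's) // -(agreeP _ _ _ ws) //; move/forall_inP: h3; apply.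
case/andP=> bl ul lT TF sep; have bT : b \notin T by apply: lT; rewrite mem_head.
pose TTg EF := TT EF && goodall T s EF.
have lT' : {in l, forall a, a \notin b |: T}.
  move=> a al; rewrite !inE negb_or lT ?inE ?al ?orbT // andbT.
  by apply: contraNneq bl => <-.
have TF' EF : TTg EF -> EF.2 \subset (b |: T) :|: [set a in l].
  case/andP=> /TF + _; move=> /subset_trans; apply; apply/subsetP => a.
  by rewrite !inE => /orP[->|/orP[->|->]]; rewrite ?orbT.
have sep' EF a : TTg EF -> separated_from EF a by case/andP=> /sep.
apply: (le_trans _ (@step T s b TT (fun EF h => sep EF b h))).
rewrite exprS -mulrA ler_wpM2l // !pairmass_child //.
have mE j : mass P (fun w => agree T w s && (w b == j)) =
    mass P ((agree (b |: T))^~ (upd s b j)).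
  by apply: eq_mass => w; rewrite agree_upd ?setU11 // setU1K.
rewrite !mE; apply: le_trans (lerD (IH _ (upd s b true) TTg ul lT' TF' sep')
  (IH _ (upd s b false) TTg ul lT' TF' sep')).
rewrite -mulrDr ler_wpM2l ?exprn_ge0 //.
rewrite (massID _ (fun w : {ffun I -> bool} => w b)) lerD //; apply: mass_sub => // w.
  case/andP=> /andP[ws /existsP[EF /and4P[h1 h2 h3 /andP[h4 h5]]]] wb.
  rewrite agree_upd ?setU11 // setU1K // ws wb; apply/existsP; exists EF.
  rewrite /TTg h1 h2 h3 h5 !andbT; apply/forallP => k; apply/implyP => cl.
  by rewrite -(good_agree k ws); apply: (implyP (forallP h4 k)).
case/andP=> /andP[ws /existsP[EF /and4P[h1 h2 h3 /andP[h4 h5]]]] wb.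
rewrite agree_upd ?setU11 // setU1K // ws (negbTE wb); apply/existsP; exists EF.
rewrite /TTg h1 h2 h3 h5 !andbT; apply/forallP => k; apply/implyP => cl.
by rewrite -(good_agree k ws); apply: (implyP (forallP h4 k)).
Qed.

Lemma allgoodPn T l w EF : ~~ allgood T l w EF ->
  exists (j : 'I_(size l)) k, clear EF k /\
    ~~ good (T :|: [set b in take j l]) w k.
Proof.
elim: l T => //= b l IH T; rewrite negb_and => /orP[/forallPn[k]|/IH[j [k [h1 h2]]]].
  rewrite negb_imply => /andP[h1 h2]; exists ord0, k; split=> //=.
  suff -> : T :|: [set x in [::]] = T by [].
  by apply/setP => x; rewrite !inE orbF.
exists (lift ord0 j), k; split=> //=.
suff -> : T :|: [set x in b :: take j l] = b |: T :|: [set x in take j l] by [].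
by apply/setP => x; rewrite !inE orbCA orbA.
Qed.

(** Union bound over the prefixes of [l] and the indices [k]. The presence of a pair clear of [N k]
    is determined off [N k], so [good_rare] applies conditionally on it. *)
Lemma diag_rare l TT :
  mass P (fun w => diag TT w && ~~ [exists EF, [&& TT EF, constant_on i EF.1 w,
     constant_on i EF.2 w & allgood set0 l w EF]]) <=
  (size l)%:R * #|K|%:R * delta * mass P (diag TT).
Proof.
pose Dk (k : K) w := [exists EF, [&& TT EF, clear EF k,
  constant_on i EF.1 w & constant_on i EF.2 w]].
pose Sj (j : 'I_(size l)) := set0 :|: [set b in take j l].
apply: (@le_trans _ _ (\sum_(jk : 'I_(size l) * K)
    mass P (fun w => Dk jk.2 w && ~~ good (Sj jk.1) w jk.2))).
  apply: mass_union_le => // w /andP[/existsP[EF /and3P[h1 h2 h3]] /existsPn /(_ EF)].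
  rewrite h1 h2 h3 /= => /allgoodPn[j [k [cl ng]]]; exists (j, k); rewrite /= ng andbT.
  by apply/existsP; exists EF; rewrite h1 h2 h3 cl.
have -> : (size l)%:R * #|K|%:R * delta * mass P (diag TT) =
    \sum_(jk : 'I_(size l) * K) delta * mass P (diag TT).
  by rewrite sumr_const card_prod card_ord -[RHS]mulr_natl natrM !mulrA.
apply: ler_sum => -[j k] _ /=; apply: (@le_trans _ _ (delta * mass P (Dk k))).
  apply: (@mass_class_le _ _ _ P_ge0 (~: N k)) => [w w' ww'|w _]; last exact: good_rare.
  case/existsP=> EF /and4P[h1 cl h2 h3]; apply/existsP; exists EF; rewrite h1 cl /=.
  move: cl; rewrite /clear disjoints_subset subUset => /andP[s1 s2].
  by rewrite (constant_on_determined s1 ww') // (constant_on_determined s2 ww').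
rewrite ler_wpM2l ?(ltW delta_gt0) //; apply: mass_sub => // w.
by case/existsP=> EF /and4P[h1 _ h2 h3]; apply/existsP; exists EF; rewrite h1 h2.
Qed.

Theorem decoupling l TT : \sum_w P w = 1 -> uniq l ->
  (forall EF, TT EF -> EF.2 \subset [set b in l]) ->
  (forall EF b, TT EF -> separated_from EF b) ->
  kappa ^+ size l * (1 - (size l)%:R * #|K|%:R * delta) * mass P (diag TT) <=
  pairmass xpredT xpredT TT.
Proof.
move=> P1 ul TF sep; have k0 : 0 <= kappa by rewrite subr_ge0.
have m1 : mass P xpredT = 1 by [].
have l0 : {in l, forall b, b \notin set0} by move=> b _; rewrite inE.
have := @decoupling_revealed l set0 ones TT ul l0.
have e1 (G : pred {ffun I -> bool}) : mass P (fun w => agree set0 w ones && G w) = mass P G.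
  by apply: eq_mass => w; rewrite agree_set0.
have -> : pairmass ((agree set0)^~ ones) ((agree set0)^~ ones) TT = pairmass xpredT xpredT TT.
  rewrite /pairmass (eq_bigl _ _ (fun w => agree_set0 w _)); apply: eq_bigr => w _.
  by rewrite (eq_bigl _ _ (fun w => agree_set0 w _)).
have -> : mass P ((agree set0)^~ ones) = 1.
  by rewrite -m1; apply: eq_mass => w; rewrite agree_set0.
rewrite divr1 e1 => /(_ _ sep) main.
apply: le_trans (main _); last by move=> EF /TF; rewrite set0U.
rewrite -mulrA ler_wpM2l ?exprn_ge0 // mulrBl mul1r.
have := diag_rare l TT; rewrite lerBlDr.
set g := fun w => [exists EF, _] => rare.
rewrite (massID (P := P) (diag TT) g) lerD // ?lerDl //.
  by apply: mass_sub => // w /andP[].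
by rewrite -massID.
Qed.

End Decoupling.

From mathcomp Require Import finmap.
From mathcomp Require Import all_classical all_reals all_analysis.
Local Open Scope classical_set_scope.

(** * Paths and distances *)

Section Paths.
Context {R : realType} {d : nat}.
Implicit Types (Q : {fset bond d}) (x y z u v : site d) (p : seq (site d)) (t : R).

Lemma adjC Q x y : adj Q x y = adj Q y x.
Proof. by apply: eq_has => e; rewrite fsetUC. Qed.

Lemma adjP Q x y :
  reflect (exists2 e, e \in Q & endpoints e = [fset x; y]%fset) (adj Q x y).
Proof. by apply: (iffP hasP) => -[e eQ /eqP h]; exists e => //; apply/eqP. Qed.

Lemma adj_sub Q Q' x y : (Q `<=` Q')%fset -> adj Q x y -> adj Q' x y.
Proof. by move=> /fsubsetP QQ' /adjP[e /QQ' eQ h]; apply/adjP; exists e. Qed.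

Lemma is_path_sub Q Q' x p y : (Q `<=` Q')%fset -> is_path Q x p y -> is_path Q' x p y.
Proof.
move=> QQ' /andP[h1 h2]; rewrite /is_path h2 andbT.
by apply: sub_path h1 => u v; apply: adj_sub.
Qed.

Lemma is_path_cat Q x p y q z : is_path Q x p y -> is_path Q y q z -> is_path Q x (p ++ q) z.
Proof.
move=> /andP[h1 /eqP h2] /andP[h3 /eqP h4].
by rewrite /is_path cat_path last_cat h1 h2 h3 h4 eqxx.
Qed.

Lemma is_path_rev Q x p y : is_path Q x p y ->
  exists2 q, is_path Q y q x & size q = size p.
Proof.
move=> /andP[h1 /eqP <-]; exists (rev (belast x p)); last by rewrite size_rev size_belast.
rewrite /is_path rev_path; apply/andP; split.
  by apply: sub_path h1 => u v; rewrite adjC.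
by case: p {h1} => //= u p; rewrite rev_cons last_rcons.
Qed.

Lemma is_path1 Q x y : adj Q x y -> is_path Q x [:: y] y.
Proof. by rewrite /is_path /= andbT eqxx => ->. Qed.

Lemma dist_geP Q x y t :
  (t%:E <= dist Q x y)%E <-> forall p, is_path Q x p y -> t <= (size p)%:R.
Proof.
split=> [h p xy|h]; last first.
  by apply/ereal_infP => _ [p xy <-]; rewrite lee_fin h.
by rewrite -lee_fin; apply: (le_trans h); apply: ereal_inf_lbound; exists p.
Qed.

(** Lengths are integers: if no path has length at most [t], all have length at least the next
    integer, which exceeds [t]. *)
Lemma dist_leP Q x y t : (dist Q x y <= t%:E)%E <->
  exists2 p, is_path Q x p y & (size p)%:R <= t.
Proof.
split=> [h|[p xy pt]]; last first.
  by apply: le_trans (_ : ((size p)%:R%:E <= _)%E); [apply: ereal_inf_lbound; exists p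
    | rewrite lee_fin].
apply: contrapT => nex.
have {}nex p : is_path Q x p y -> t < (size p)%:R.
  by move=> xy; rewrite ltNge; apply/negP => pt; apply: nex; exists p.
have [t0|t0] := ltP t 0.
  have : ((0 : R)%:E <= dist Q x y)%E by apply/dist_geP => p _.
  by move=> /le_trans /(_ h); rewrite lee_fin leNgt t0.
have : (((Num.truncn t).+1%:R : R)%:E <= dist Q x y)%E.
  apply/dist_geP => p /nex tp; rewrite ler_nat.
  by rewrite -(ltr_nat R); apply: le_lt_trans tp; rewrite truncn_le.
move=> /le_trans /(_ h); rewrite lee_fin leNgt => /negP; apply.
by rewrite truncnS_gt.
Qed.

Lemma bond_dist_geP Q E F t : (t%:E <= bond_dist Q E F)%E <->
  forall x y p, x \in vertices E -> y \in vertices F -> is_path Q x p y -> t <= (size p)%:R.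
Proof.
split=> [h x y p xE yF xy|h].
  rewrite -lee_fin; apply: (le_trans h).
  apply: (@le_trans _ _ (dist Q x y)); first by apply: ereal_inf_lbound; exists x, y.
  by apply: ereal_inf_lbound; exists p.
apply/ereal_infP => _ [x [y [xE yF ->]]]; apply/dist_geP => p; exact: h.
Qed.

Lemma bond_dist_le Q E F x y p t : x \in vertices E -> y \in vertices F ->
  is_path Q x p y -> (size p)%:R <= t -> (bond_dist Q E F <= t%:E)%E.
Proof.
move=> xE yF xy pt; apply: (@le_trans _ _ (dist Q x y)); last by apply/dist_leP; exists p.
by apply: ereal_inf_lbound; exists x, y.
Qed.

Lemma verticesP E x : reflect (exists2 e : bond d, e \in E & x \in endpoints e) (x \in vertices E).
Proof.
apply: (iffP (bigfcupP _ _ _ _)) => [[e]|[e eE xe]]; first by rewrite andbT; exists e.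
by exists e; rewrite ?eE.
Qed.

Lemma endpoints_two (e : bond d) : exists x y, x != y /\ endpoints e = [fset x; y]%fset.
Proof.
have e2 : #|` endpoints e| = 2%N by have /andP[/eqP] := valP e.
have [x xe] : exists x, x \in endpoints e.
  by case: (fset_0Vmem (endpoints e)) e2 => [->|[x xe]]; [rewrite cardfs0 | exists x].
have : #|` (endpoints e `\ x)%fset| == 1%N by move: e2; rewrite (cardfsD1 x) xe add1n => -[->].
move=> /cardfs1P[y ye]; exists x, y.
have : y \in (endpoints e `\ x)%fset by rewrite ye inE.
by rewrite !inE eq_sym => /andP[-> _]; split=> //; rewrite -ye fsetD1K.
Qed.

Lemma endpoints_adj Q (e : bond d) x y : e \in Q -> x \in endpoints e -> y \in endpoints e ->
  x != y -> adj Q x y.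
Proof.
move=> eQ xe ye xy; apply/adjP; exists e => //.
have [a [b [ab ebE]]] := endpoints_two e; move: xe ye xy; rewrite ebE !inE.
case/orP=> /eqP -> /orP[] /eqP ->; rewrite ?eqxx //.
by rewrite fsetUC.
Qed.

(** First-exit decomposition, used below for balls, for the moat and for vertex sets. *)
Lemma is_path_step Q x p y (Pr : site d -> Prop) : is_path Q x p y -> Pr x -> ~ Pr y ->
  exists p1 z z' p2, [/\ p = p1 ++ z' :: p2, is_path Q x p1 z,
    (forall u, u \in x :: p1 -> Pr u), ~ Pr z' & adj Q z z'].
Proof.
elim: p x => [|u p IH] x; first by rewrite /is_path /= => /eqP <-.
rewrite /is_path /= -andbA => /andP[xu uy] Px nPy.
have [Pu|nPu] := pselect (Pr u); last first.
  exists [::], x, u, p; split=> //; first by rewrite /is_path /=.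
  by move=> w; rewrite inE => /eqP ->.
have [p1 [z [z' [p2 [-> h2 h4 h5 h6]]]]] := IH u uy Pu nPy.
exists (u :: p1), z, z', p2; split=> //.
  by move: h2; rewrite /is_path /= xu.
by move=> w; rewrite inE => /orP[/eqP -> //|/h4].
Qed.

Lemma is_path_last Q x p y : is_path Q x p y -> y \in x :: p.
Proof. by move=> /andP[_ /eqP <-]; apply: mem_last. Qed.

Lemma is_path_suffix Q x p1 z' p2 y : is_path Q x (p1 ++ z' :: p2) y -> is_path Q z' p2 y.
Proof. by rewrite /is_path cat_path last_cat /= => /andP[/and3P[_ _ ->]]. Qed.

End Paths.

(** * Separation of witnesses *)

Section Separation.
Context {R : realType} {d : nat}.
Variables (Q D V : {fset bond d}) (N : site d -> {fset bond d}) (c r : R).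
Implicit Types (x y z u v : site d) (p : seq (site d)) (t : R) (w : conf Q).
Implicit Types (E F H : {set Q}) (b e : Q).

Definition fends e : {set vertices Q} := finset (fun v : vertices Q => val v \in endpoints (val e)).

(** Being within distance [t] of [H] in [Q], stated through an explicit path so that bounds add up
    by concatenation. *)
Definition near H t z : Prop := exists2 h, h \in H &
  exists v p, [/\ v \in endpoints (val h), is_path Q z p v & (size p)%:R <= t].

Definition far_apart E F : Prop := forall e f x y p, e \in E -> f \in F ->
  x \in endpoints (val e) -> y \in endpoints (val f) -> is_path Q x p y ->
  r <= (size p)%:R.

(* [x] is joined inside its neighborhood [N x] to a remote site; requiring that site
   to be in [vertices V] makes the union bound depend on [V] only. *)
Definition exits x w : Prop := exists y, [/\ y \in vertices V,
  (forall p, is_path (N x) x p y -> r / 16 / c - 1 < (size p)%:R) &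
  exists p, is_path [fset e in N x | state w e]%fset x p y].

Lemma state_val w e : state w (val e) = w e.
Proof. by rewrite /state valK. Qed.

Lemma endpoints_vertices e v : v \in endpoints (val e) -> v \in vertices Q.
Proof. by move=> ve; apply/verticesP; exists (val e) => //; apply: fsvalP. Qed.

Lemma connect_open_path w (u v : vertices Q) : connect (open_rel (ends := fends) w) u v ->
  exists p, is_path (open_bonds w) (val u) p (val v).
Proof.
case/connectP => q uq ->; elim: q u uq => [|z q IH] u /=.
  by move=> _; exists [::]; rewrite /is_path /=.
case/andP=> /existsP[e /and3P[we]]; rewrite !inE => ue ze /IH[p zp].
have [uzE|uz] := eqVneq (val u) (val z); first by exists p; rewrite uzE.
have eo : val e \in open_bonds w by rewrite !inE /= state_val we (fsvalP e).
exists (val z :: p); apply: (@is_path_cat _ _ _ [:: val z] (val z)) zp; apply: is_path1.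
exact: endpoints_adj eo ue ze uz.
Qed.

Lemma touching H w b :
  ~~ (H \subset outer_bonds (ends := fends) (open_cluster (ends := fends) w b)) ->
  exists2 h, h \in H & exists u v p,
    [/\ u \in endpoints (val b), v \in endpoints (val h) & is_path (open_bonds w) u p v].
Proof.
case/subsetPn=> h hH; rewrite inE => /pred0Pn[v /andP[]]; rewrite !inE => vh.
case/existsP=> u /andP[]; rewrite inE => ub /connect_open_path[p uv].
by exists h => //; exists (val u), (val v), p.
Qed.

Lemma near_mono H t t' z : t <= t' -> near H t z -> near H t' z.
Proof.
move=> tt' [h hH [v [p [vh zv pt]]]]; exists h => //; exists v, p; split=> //.
exact: le_trans tt'.
Qed.

Lemma near_path H t z z' p : is_path Q z' p z -> near H t z -> near H ((size p)%:R + t) z'.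
Proof.
move=> z'z [h hH [v [q [vh zv pt]]]]; exists h => //; exists v, (p ++ q); split=> //.
  exact: is_path_cat zv.
by rewrite size_cat natrD lerD2l.
Qed.

Lemma near_endpoint H h v : h \in H -> v \in endpoints (val h) -> near H 0 v.
Proof. by move=> hH vh; exists h => //; exists v, [::]; split; rewrite // /is_path /=. Qed.

Lemma near_enlarge H t e z : (forall h, h \in H -> val h \in D) -> near H t z -> t <= r ->
  z \in endpoints (val e) -> val e \in enlarge Q D r.
Proof.
move=> HD [h /HD hD [v [p [vh zv pt]]]] tr ze; rewrite !inE /= (fsvalP e) /=.
apply: (bond_dist_le (x := z) (y := v) _ _ zv); last exact: le_trans tr.
  by apply/verticesP; exists (val e); rewrite ?inE.
by apply/verticesP; exists (val h).
Qed.

Lemma open_bonds_sub w : (open_bonds w `<=` Q)%fset.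
Proof. by apply/fsubsetP => e; rewrite !inE => /andP[]. Qed.

Hypothesis c_gt1 : 1 < c.
Hypothesis r_ge : 16 * c <= r.
Hypothesis N_nbhd : forall x, x \in vertices Q -> approx_nbhd c (r / 16) Q x (N x).
Hypothesis DV : (enlarge Q D r `<=` V)%fset.

Let c_gt0 : 0 < c. Proof. by apply: lt_trans c_gt1. Qed.
Let r_ge16 : 16 <= r.
Proof. by apply: le_trans r_ge; rewrite ler_peMr // ltW. Qed.
Let rc_ge1 : 1 <= r / 16 / c.
Proof. by rewrite -mulrA -invfM ler_pdivlMr ?mul1r // mulr_gt0. Qed.
Let rc_le : r / 16 / c <= r / 16.
Proof. by rewrite ler_pdivrMr // ler_peMr ?(ltW c_gt1) // divr_ge0 // (le_trans _ r_ge16). Qed.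

(** [N x] lies in the ball of radius [r / 16], so a bond of [F] in [N x] puts [F] within [r / 16] of
    [x]. *)
Lemma far_nbhd F e x t : x \in vertices Q -> val e \in N x -> e \in F ->
  ~ near F t x -> t < r / 16.
Proof.
move=> xQ eN eF nf; rewrite ltNge; apply/negP => rt; apply: nf.
have [_ /fsubsetP /(_ _ eN)] := N_nbhd xQ.
have [y [z [yz eE]]] := endpoints_two (val e).
have ye : y \in endpoints (val e) by rewrite eE !inE eqxx.
rewrite !inE /= => /andP[_ /forallP /(_ [` ye]%fset)] /= /dist_leP[p xy pr].
exists e => //; exists y, p; split=> //; exact: le_trans rt.
Qed.

(** Stop the open path at its first site [y] outside the ball of radius [r / 16 / c - 1]. The
    missing unit pays for the last step, so the bonds used lie in the ball of radius [r / 16 / c],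
    hence in [N x]; and [y] is close enough to [F] to be an endpoint of a bond of [V]. *)
Lemma exit_path F w x p v : (forall h, h \in F -> val h \in D) ->
  is_path (open_bonds w) x p v ->
  near F (5 * r / 8 + 1) x ->
  (forall q, is_path Q x q v -> r / 16 / c - 1 < (size q)%:R) ->
  [/\ x \in vertices Q, x \in vertices V & exits x w].
Proof.
move=> FD xv nx far.
pose inball z := exists2 q, is_path Q x q z & (size q)%:R <= r / 16 / c - 1.
have px : inball x.
  by exists [::]; [rewrite /is_path /= | rewrite subr_ge0].
have nv : ~ inball v by case=> q /far; rewrite ltNge => /negP.
have [p1 [z [y [p2 [pE xz ball ny zy]]]]] := is_path_step xv px nv.
have [q1 xq1 size_q1] := ball z (is_path_last xz).
have sub := fsubsetP (open_bonds_sub w).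
have [e1 e1o e1E] := adjP _ _ _ zy; have e1Q := sub _ e1o.
have [e0 e0Q xe0] : exists2 e : Q, val e \in open_bonds w & x \in endpoints (val e).
  case: p xv pE => [|a p] xv pE; first by case: (p1) pE.
  move: xv; rewrite /is_path /= => /andP[/andP[/adjP[e eo eE] _] _].
  by exists [` sub _ eo]%fset; rewrite //= eE !inE eqxx.
have xQ : x \in vertices Q by apply: endpoints_vertices xe0.
have zyQ : adj Q z y by apply: adj_sub zy; apply: open_bonds_sub.
have xyQ : is_path Q x (q1 ++ [:: y]) y by apply: is_path_cat xq1 (is_path1 zyQ).
have size_xy : (size (q1 ++ [:: y]))%:R <= r / 16 / c.
  by rewrite size_cat natrD -lerBrDr.
have xV : x \in vertices V.
  apply/verticesP; exists (val e0) => //; apply: (fsubsetP DV).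
  by apply: near_enlarge FD nx _ xe0; move: r_ge16; lra.
split=> //; exists y; split.
- have [q yx size_q] := is_path_rev xyQ.
  have ny' := near_path yx nx.
  apply/verticesP; exists e1; last by rewrite e1E !inE eqxx orbT.
  apply: (fsubsetP DV); have := near_enlarge (e := [` e1Q]%fset) FD ny'.
  apply; last by rewrite /= e1E !inE eqxx orbT.
  by rewrite size_q; move: size_xy rc_le r_ge16; lra.
- move=> q xy; rewrite ltNge; apply/negP => qs; apply: ny; exists q => //.
  have [_ NQ] := N_nbhd xQ; apply: is_path_sub xy; apply: fsubset_trans NQ _.
  by apply/fsubsetP => e; rewrite !inE => /andP[].
- exists (p1 ++ [:: y]); have openN u u' : inball u -> adj (open_bonds w) u u' ->
    adj Q u u' -> adj [fset e in N x | state w e]%fset u u'.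
    move=> [q xu qs] /adjP[e]; rewrite !inE /= => /andP[eQ we] eE uu'.
    have xu' : is_path Q x (q ++ [:: u']) u' by apply: is_path_cat xu (is_path1 uu').
    apply/adjP; exists e => //; rewrite !inE /= we andbT.
    have [/fsubsetP Nsub _] := N_nbhd xQ; apply: Nsub; rewrite !inE /= eQ /=.
    apply/forallP => -[a /= ae]; apply/dist_leP; move: ae; rewrite eE !inE.
    case/orP=> /eqP ->; [exists q | exists (q ++ [:: u'])] => //.
      by move: qs; lra.
    by rewrite size_cat natrD -lerBrDr.
  apply: (@is_path_cat _ _ _ p1 z); last first.
    apply: is_path1; apply: openN => //; exact: ball (is_path_last xz).
  have pathN q u : path (adj (open_bonds w)) u q -> {in u :: q, forall a, inball a} ->
      path (adj [fset e in N x | state w e]%fset) u q.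
    elim: q u => // a q IH u /andP[ua aq] uball; apply/andP; split.
      apply: (openN _ _ _ ua); first by apply: uball; rewrite inE eqxx.
      by apply: adj_sub ua; apply: open_bonds_sub.
    by apply: IH aq _ => a' ha; apply: uball; rewrite inE ha orbT.
  by move: xz; rewrite /is_path => /andP[xp1 ->]; rewrite andbT pathN.
Qed.

Definition shields E F b x w : Prop :=
  [/\ x \in vertices V, val b \notin N x, forall e, e \in E :|: F -> val e \notin N x &
   exits x w].

(* A path from [b] to [F] (if [b] is at distance [r/2] from [F]) or to [E] (if not)
   crosses the middle of the moat between [E] and [F]. *)
Lemma separation E F b : far_apart E F -> (forall h, h \in F -> val h \in D) ->
  (forall w, ~~ (F \subset outer_bonds (ends := fends) (open_cluster (ends := fends) w b)) ->
     exists x, shields E F b x w) \/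
  (forall w, ~~ (E \subset outer_bonds (ends := fends) (open_cluster (ends := fends) w b)) ->
     exists x, shields E F b x w).
Proof.
move=> EF FD.
have E_far e v t : e \in E -> v \in endpoints (val e) -> near F t v -> r <= t.
  move=> eE ve [f fF [y [p [yf vy pt]]]].
  exact: le_trans (EF _ _ _ _ _ eE fF ve yf vy) pt.
have E_far_path x e v t q : e \in E -> v \in endpoints (val e) -> is_path Q x q v ->
    near F t x -> r <= (size q)%:R + t.
  move=> eE ve xv nx; have [q' vx <-] := is_path_rev xv.
  exact: E_far eE ve (near_path vx nx).
have F_far_path x f v q : f \in F -> v \in endpoints (val f) -> is_path Q x q v ->
    near F (size q)%:R x.
  by move=> fF vf xv; exists f => //; exists v, q.
have clearN x : x \in vertices Q -> near F (5 * r / 8 + 1) x -> ~ near F (3 * r / 8) x ->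
    forall e, e \in E :|: F -> val e \notin N x.
  move=> xQ n5 n3 e; rewrite inE => /orP[eE|eF]; apply/negP => eN; last first.
    by have := far_nbhd xQ eN eF n3; move: r_ge16; lra.
  have : ~ near E (r / 16) x.
    case=> e' e'E [v [q [ve' xv qs]]]; have := E_far_path _ _ _ _ _ e'E ve' xv n5.
    by move: qs r_ge16; lra.
  by move=> /(far_nbhd xQ eN eE); rewrite ltxx.
have nb x : x \in vertices Q -> val b \in N x -> exists2 u, u \in endpoints (val b) &
    exists2 q, is_path Q x q u & (size q)%:R <= r / 16.
  move=> xQ bN; apply: contrapT => nex.
  have : ~ near [set b]%SET (r / 16) x.
    by case=> b'; rewrite inE => /eqP -> [v [q [vb xv qs]]]; apply: nex; exists v; last exists q.
  by move=> /(far_nbhd xQ bN (set11 _)); rewrite ltxx.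
have allb u u' t : u \in endpoints (val b) -> u' \in endpoints (val b) -> near F t u ->
    near F (t + 1) u'.
  move=> ub u'b nu; have [<-|u'u] := eqVneq u u'; first by apply: near_mono nu; rewrite lerDl.
  rewrite addrC; apply: (near_path (p := [:: u])) nu; apply: is_path1.
  by apply: endpoints_adj (fsvalP b) u'b ub _; rewrite eq_sym.
(* If [b] is within [r / 2] of [F], the path towards [E] is cut at level [5 * r / 8]. The gap
   [r / 8] to [b] covers the radius [r / 16] and one extra step, as [r >= 16]. *)
have [[u0 u0b nu0]|bfar] := pselect (exists2 u, u \in endpoints (val b) & near F (r / 2) u).
  right=> w /touching[e eE [u [v [p [ub ve uv]]]]].
  have nu : near F (5 * r / 8) u.
    by apply: near_mono (allb _ _ _ u0b ub nu0); move: r_ge16; lra.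
  have nv : ~ near F (5 * r / 8) v by move=> /(E_far _ _ _ eE ve); move: r_ge16; lra.
  have [p1 [z [x [p2 [pE uz ball nx zx]]]]] := is_path_step uv nu nv.
  have xv : is_path (open_bonds w) x p2 v by move: uv; rewrite pE; apply: is_path_suffix.
  have xz : is_path Q x [:: z] z.
    by apply: is_path1; rewrite adjC; apply: adj_sub zx; apply: open_bonds_sub.
  have n5 : near F (5 * r / 8 + 1) x.
    by rewrite addrC; apply: near_path xz (ball _ (is_path_last uz)).
  have [q|xQ xV Jx] := exit_path FD xv n5.
    by move=> /(E_far_path _ _ _ _ _ eE ve) /(_ n5); move: r_ge16 rc_le; lra.
  exists x; split=> //; last first.
    by apply: clearN => //; apply: contra_not nx; apply: near_mono; move: r_ge16; lra.
  apply/negP => bN; have [u' u'b [q xu' qs]] := nb _ xQ bN.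
  apply: nx; apply: near_mono (near_path xu' (allb _ _ _ u0b u'b nu0)).
  by move: qs r_ge16; lra.
(* If [b] is farther away, the path towards [F] is cut at level [3 * r / 8], again with a gap
   [r / 8]. *)
left=> w /touching[f fF [u [v [p [ub vf uv]]]]].
have nu : ~ near F (3 * r / 8) u.
  by apply: contra_not bfar => nu; exists u => //; apply: near_mono nu; move: r_ge16; lra.
have nv : ~ ~ near F (3 * r / 8) v.
  by apply; apply: near_mono (near_endpoint fF vf); move: r_ge16; lra.
have [p1 [x [z [p2 [pE ux far nz xz]]]]] :=
  is_path_step (Pr := fun y => ~ near F (3 * r / 8) y) uv nu nv.
have nx := far _ (is_path_last ux); have {}nz := contrapT nz.
have xv : is_path (open_bonds w) x (z :: p2) v.
  apply: (@is_path_cat _ _ _ [:: z] z); first exact: is_path1.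
  by move: uv; rewrite pE; apply: is_path_suffix.
have xz' : is_path Q x [:: z] z.
  by apply: is_path1; apply: adj_sub xz; apply: open_bonds_sub.
have n3 : near F (3 * r / 8 + 1) x by rewrite addrC; apply: near_path xz' nz.
have n5 : near F (5 * r / 8 + 1) x by apply: near_mono n3; move: r_ge16; lra.
have [q|xQ xV Jx] := exit_path FD xv n5.
  move=> /(F_far_path _ _ _ _ fF vf) nxq; rewrite ltNge; apply/negP => qs; apply: nx.
  by apply: near_mono nxq; move: qs r_ge16 rc_le; lra.
exists x; split=> //; last exact: clearN.
apply/negP => bN; have [u' u'b [q xu' qs]] := nb _ xQ bN.
apply: bfar; exists u' => //; have [q' u'x size_q] := is_path_rev xu'.
by apply: near_mono (near_path u'x n3); rewrite size_q; move: qs r_ge16; lra.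
Qed.

End Separation.

(** * From the abstract setting to bond configurations *)

Section Events.
Context {R : realType} {d : nat} {Q : {fset bond d}}.
Implicit Types (P : meas R Q) (w : conf Q) (S : {set Q}) (X : {fset bond d}).

Definition bonds_of S : {fset bond d} := [fset val e | e in S]%fset.

Lemma bonds_ofE S (e : Q) : (val e \in bonds_of S) = (e \in S).
Proof. by rewrite mem_imfset //; apply: val_inj. Qed.

Lemma bonds_ofP S a : reflect (exists2 e : Q, e \in S & a = val e) (a \in bonds_of S).
Proof. exact: imfsetP. Qed.

Lemma bonds_of_sub S : (bonds_of S `<=` Q)%fset.
Proof. by apply/fsubsetP => a /bonds_ofP[e _ ->]; apply: fsvalP. Qed.

Lemma restr_eqP X w w' : (X `<=` Q)%fset ->
  restr X w = restr X w' <-> forall e : Q, val e \in X -> w e = w' e.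
Proof.
move=> /fsubsetP XQ; split=> [h e eX|h].
  have /ffunP /(_ [` eX]%fset) := h; by rewrite !ffunE /= !state_val.
apply/ffunP => a; rewrite !ffunE; have aQ := XQ _ (fsvalP a).
by have := h [` aQ]%fset (fsvalP a); rewrite -!state_val.
Qed.

Lemma restr_rhoP X i w : (X `<=` Q)%fset ->
  restr X w = rho i X <-> forall e : Q, val e \in X -> w e = i.
Proof.
move=> /fsubsetP XQ; split=> [h e eX|h].
  have /ffunP /(_ [` eX]%fset) := h; by rewrite !ffunE /= !state_val.
apply/ffunP => a; rewrite !ffunE; have aQ := XQ _ (fsvalP a).
by have := h [` aQ]%fset (fsvalP a); rewrite -!state_val.
Qed.

Lemma determined_restr S (A : pred (conf Q)) : determined S A ->
  exists A0 : set (conf (bonds_of S)), forall w, A0 (restr (bonds_of S) w) <-> A w.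
Proof.
move=> dA; exists [set h | exists2 w, A w & restr (bonds_of S) w = h] => w; split; last by exists w.
case=> w' Aw' /restr_eqP ww'; apply: dA Aw'; apply/agreeP => e eS.
by apply: ww'; rewrite ?bonds_ofE //; apply: bonds_of_sub.
Qed.

Lemma prE P (A : set (conf Q)) (G : pred (conf Q)) : (forall w, A w <-> G w) ->
  pr P A = mass P G.
Proof.
by move=> AG; apply: eq_bigl => w; apply/asboolP/idP => /AG.
Qed.

Local Notation ends := (@fends d Q).

Lemma fends_neq0 (e : Q) : ends e != finset.set0.
Proof.
have [x [y [_ exy]]] := endpoints_two (val e).
have xe : x \in endpoints (val e) by rewrite exy !inE eqxx.
apply/set0Pn; exists [` endpoints_vertices xe]%fset.
by rewrite inE.
Qed.

(** A path from a site of [c] to a site off [c] takes a bond with exactly one end in [c], which is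
    neither inner nor outer. Inner and outer bonds are disjoint because every bond has an end. *)
Lemma cluster_blocking (c : {set vertices Q}) :
  blocking_partition Q (bonds_of (inner_bonds (ends := ends) c))
    (bonds_of (boundary_bonds (ends := ends) c)) (bonds_of (outer_bonds (ends := ends) c)).
Proof.
have in_out e : e \in inner_bonds (ends := ends) c -> e \in outer_bonds (ends := ends) c -> False.
  rewrite !inE => /fintype.subsetP sub /pred0P dis; have /set0Pn[v ve] := fends_neq0 e.
  by have := dis v; rewrite /= ve (sub _ ve).
split.
- apply/fsetP => a; rewrite !in_fsetU; apply/orP/idP => [[/orP[]|]|aQ];
    do ?by apply: (fsubsetP (bonds_of_sub _)).
  have -> : a = val [` aQ]%fset by [].
  rewrite !bonds_ofE [_ \in boundary_bonds _]inE finset.in_setU.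
  by case: (_ \in inner_bonds c); case: (_ \in outer_bonds c); [left|left|right|left].
- split; apply/fdisjointP => a /bonds_ofP[e eS ->]; rewrite bonds_ofE; apply/negP.
  + by move=> eY; move: eY; rewrite inE finset.in_setU eS.
  + exact: in_out.
  + by move=> eZ; move: eS; rewrite inE finset.in_setU eZ orbT.
- move=> x z p /verticesP[a /bonds_ofP[e + ->] xe] /verticesP[a' /bonds_ofP[e' + ->] ze'] xz.
  rewrite !inE => /fintype.subsetP /(_ [` endpoints_vertices xe]%fset); rewrite inE => /(_ xe) xc.
  move=> /pred0P /(_ [` endpoints_vertices ze']%fset); rewrite /= inE /= ze' /= => zc.
  pose Pr y := exists2 v : vertices Q, v \in c & val v = y.
  have px : Pr x by exists [` endpoints_vertices xe]%fset.
  have nz : ~ Pr z.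
    case=> v vc vz; move: zc; have -> : [` endpoints_vertices ze']%fset = v by apply: val_inj.
    by rewrite vc.
  have [p1 [y [y' [p2 [-> xy py ny' yy']]]]] := is_path_step xz px nz.
  have [v vc vy] := py _ (is_path_last xy).
  rewrite /path_uses; apply/hasP; exists true => //.
  have [_ /eqP ly] := andP xy.
  rewrite pairmap_cat /= ly mem_cat inE; apply/orP; right; apply/orP; left.
  have [f fQ fE] := adjP _ _ _ yy'; apply/eqP/esym/adjP; exists f => //.
  have -> : f = val [` fQ]%fset by [].
  have vf : v \in ends [` fQ]%fset by rewrite inE vy /= fE !inE eqxx.
  have y'f : y' \in endpoints (val [` fQ]%fset) by rewrite /= fE !inE eqxx orbT.
  rewrite bonds_ofE inE finset.in_setU negb_or; apply/andP; split.
    apply/negP; rewrite inE => /fintype.subsetP /(_ [` endpoints_vertices y'f]%fset).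
    by rewrite inE => /(_ y'f) h; apply: ny'; exists [` endpoints_vertices y'f]%fset.
  apply/negP; rewrite inE => /pred0P /(_ v) /=.
  by rewrite vf vc.
Qed.

Lemma markov_mass P : (forall w, 0 <= P w) -> markov_blocking P -> forall c A B,
  determined (inner_bonds (ends := ends) c) A -> determined (outer_bonds (ends := ends) c) B ->
  let Y := closed_on (boundary_bonds (ends := ends) c) in
  mass P (fun w => A w && B w && Y w) * mass P Y =
  mass P (fun w => A w && Y w) * mass P (fun w => B w && Y w).
Proof.
move=> P_ge0 markov c A B /determined_restr[A0 A0E] /determined_restr[B0 B0E] Y.
have [y0|y0] := eqVneq (mass P Y) 0.
  have z A1 : mass P (fun w => A1 w && Y w) = 0.
    apply/eqP; rewrite eq_le mass_ge0 // andbT -y0; apply: mass_sub => // w.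
    by case/andP.
  by rewrite !z !mul0r.
have CE w : [set w : conf Q | restr (bonds_of (boundary_bonds (ends := ends) c)) w =
    rho false (bonds_of (boundary_bonds (ends := ends) c))] w <-> Y w.
  rewrite /=; split=> [/restr_rhoP h|/forall_inP h].
    by apply/forall_inP => e eY; rewrite h // ?bonds_ofE //; apply: bonds_of_sub.
  apply/restr_rhoP; first exact: bonds_of_sub.
  by move=> e; rewrite bonds_ofE => /h /negbTE.
have := markov _ _ _ (cluster_blocking c); rewrite /cond_indep_closed /= /cpr.
rewrite (prE P (G := Y)) // => /(_ _ A0 B0).
rewrite (prE P (G := fun w => A w && B w && Y w)); last first.
  move=> w; split=> [[[/A0E aw /B0E bw] /CE yw]|/andP[/andP[/A0E aw /B0E bw] /CE yw]] //.
  by rewrite aw bw yw.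
rewrite (prE P (G := fun w => A w && Y w)); last first.
  by move=> w; split=> [[/A0E aw /CE yw]|/andP[/A0E aw /CE yw]] //; rewrite aw yw.
rewrite (prE P (G := fun w => B w && Y w)); last first.
  by move=> w; split=> [[/B0E aw /CE yw]|/andP[/B0E aw /CE yw]] //; rewrite aw yw.
rewrite lt_def y0 mass_ge0 // => /(_ isT) h.
have {}h : mass P (fun w => A w && B w && Y w) =
  mass P (fun w => A w && Y w) * mass P (fun w => B w && Y w) / mass P Y.
  by apply: (mulIf (invr_neq0 y0)); rewrite h; field.
by rewrite h divfK.
Qed.

End Events.

Lemma card_vertices d (V : {fset bond d}) : (#|` vertices V| <= 2 * #|` V|)%N.
Proof.
suff le (s : seq (bond d)) : (#|` \bigcup_(e <- s) endpoints e|%fset <= 2 * size s)%N.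
  exact: le.
elim: s => [|e s IH]; first by rewrite big_nil cardfs0.
rewrite big_cons; apply: leq_trans (leq_card_fsetU _ _) _.
have -> : #|` endpoints e| = 2%N by have /andP[/eqP] := valP e.
by rewrite /= mulnS leq_add2l.
Qed.

Lemma bernoulli_le (R : realFieldType) (x : R) n : 0 <= x <= 1 -> 1 - n%:R * x <= (1 - x) ^+ n.
Proof.
case/andP=> x0 x1; elim: n => [|n IH]; first by rewrite mul0r subr0 expr0.
apply: (@le_trans _ _ ((1 - x) * (1 - n%:R * x))); last first.
  by rewrite exprS ler_wpM2l // subr_ge0.
have : 0 <= n%:R * x * x by rewrite !mulr_ge0.
by rewrite -natr1; lra.
Qed.

(** With [t = 2 * M ^+ 2 * delta <= 1 / 4], both factors are at least [1 - t], the power by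
    Bernoulli's inequality, and [(1 + 4 * t) * (1 - t) ^+ 2 >= 1] in that range. In the application
    [M] counts the bonds of [V] and [m] its sites. *)
Lemma decoupling_factor (R : realFieldType) (l : nat) (m M delta p q : R) :
  0 <= m -> m <= 2 * M -> l%:R <= M -> 0 <= delta -> m * delta <= 1 ->
  8 * M ^+ 2 * delta <= 1 -> 0 <= p ->
  (1 - m * delta) ^+ l * (1 - l%:R * m * delta) * p <= q ->
  p <= (1 + 8 * M ^+ 2 * delta) * q.
Proof.
move=> m0 mM lM d0 md small p0 pq.
have tau : l%:R * m * delta <= 2 * M ^+ 2 * delta.
  by rewrite ler_wpM2r // expr2 mulrCA; apply: ler_pM.
have -> : 8 * M ^+ 2 * delta = 4 * (2 * M ^+ 2 * delta) by ring.
have : 4 * (2 * M ^+ 2 * delta) <= 1 by lra.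
have : 0 <= 2 * M ^+ 2 * delta by rewrite !mulr_ge0 ?exprn_ge0 // (le_trans _ lM).
move: tau; set t := 2 * M ^+ 2 * delta => tau t0 t4.
have bern : 1 - t <= (1 - m * delta) ^+ l.
  apply: le_trans (bernoulli_le l _); last by rewrite md mulr_ge0.
  by rewrite mulrA; lra.
have p_le : (1 - t) ^+ 2 * p <= q.
  apply: le_trans pq; rewrite expr2.
  by apply: ler_pM => //; [rewrite mulr_ge0 //; lra | apply: ler_pM => //; lra].
apply: (@le_trans _ _ ((1 + 4 * t) * ((1 - t) ^+ 2 * p))); last first.
  by rewrite ler_wpM2l // addr_ge0 // mulr_ge0.
rewrite mulrA ler_peMl // -subr_ge0.
rewrite [X in 0 <= X](_ : _ = t * (2 - 7 * t + 4 * t ^+ 2)); last by ring.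
by rewrite mulr_ge0 // expr2; nra.
Qed.

(** * Both events increasing or both decreasing *)

Section SameDirection.
Context {R : realType} {d : nat}.
Variables (Q D V : {fset bond d}) (P : meas R Q) (N : site d -> {fset bond d}).
Variables (c r delta : R).
Implicit Types (w : conf Q) (E F H : {set Q}) (A B : set (conf Q)).

Local Notation ends := (@fends d Q).

Definition nbhd_set (X : {fset bond d}) : {set Q} := finset (fun e : Q => val e \in X).

Definition toward (i : bool) A := if i then increasing_event A else decreasing_event A.

(** The least favorable configuration, for events toward [i], among those in state [i] on [E]: its
    membership says that [E] in state [i] forces the event. *)
Definition pattern (i : bool) E : conf Q := [ffun e => if e \in E then i else ~~ i].

Lemma exits_up x : up_closed (fun w => `[< exits V N c r x w >]).
Proof.
move=> w w' /cleP ww' /asboolP[y [yV far [p xy]]]; apply/asboolP; exists y; split=> //.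
exists p; apply: is_path_sub xy; apply/fsubsetP => e; rewrite !inE => /andP[-> /=].
by rewrite /state; case: insubP => // u _ _; apply: ww'.
Qed.

Hypothesis P_ge0 : forall w, 0 <= P w.
Hypothesis P_sum : \sum_w P w = 1.
Hypothesis P_fkg : FKG_lattice P.
Hypothesis P_markov : markov_blocking P.
Hypothesis P_ones : 0 < P [ffun=> true].
Hypothesis c_gt1 : 1 < c.
Hypothesis r_ge : 16 * c <= r.
Hypothesis N_nbhd : forall x, x \in vertices Q -> approx_nbhd c (r / 16) Q x (N x).
Hypothesis DQ : (D `<=` Q)%fset.
Hypothesis DV : (enlarge Q D r `<=` V)%fset.
Hypothesis delta_gt0 : 0 < delta.
Hypothesis wired : forall x, x \in vertices V ->
  mass P (fun w => agree (~: nbhd_set (N x)) w [ffun=> true] && `[< exits V N c r x w >]) <=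
  delta ^+ 2 * mass P ((agree (~: nbhd_set (N x)))^~ [ffun=> true]).

Let r_ge0 : 0 <= r.
Proof. by apply: le_trans r_ge; rewrite mulr_ge0 // ltW // (lt_trans _ c_gt1). Qed.

Lemma D_sub_V : (D `<=` V)%fset.
Proof.
apply/fsubsetP => a aD; apply: (fsubsetP DV); rewrite !inE /= (fsubsetP DQ _ aD) /=.
have [x [y [_ aE]]] := endpoints_two a.
have xa : x \in endpoints a by rewrite aE !inE eqxx.
apply: (bond_dist_le (x := x) (y := x) (p := [::])) => //.
- by apply/verticesP; exists a; rewrite ?inE.
- by apply/verticesP; exists a; [exact: aD | exact: xa].
- by rewrite /is_path /=.
Qed.

Lemma pattern_toward i E w A : toward i A -> A (pattern i E) -> constant_on i E w -> A w.
Proof.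
case: i => /= [up|down] pE /forall_inP wE.
  apply: up pE _ => e; rewrite /pattern ffunE.
  by case: ifP => // eE _; apply/eqP/wE.
apply: contrapT => nA; apply: down nA _ pE => e we; rewrite /pattern ffunE.
by case: ifP => // eE; move: we; rewrite (eqP (wE _ eE)).
Qed.

Lemma same_direction i A B : in_G D B -> toward i A -> toward i B ->
  8 * #|` V|%:R ^+ 2 * delta <= 1 ->
  pr P (disjoint_occurrence r A B) <= (1 + 8 * #|` V|%:R ^+ 2 * delta) * pr P A * pr P B.
Proof.
move=> [B0 BE] Ai Bi small.
(* For monotone events occurrence on a set is witnessed by its bonds in state [i]. *)
pose TT : pred ({set Q} * {set Q}) := fun EF => `[< [/\ far_apart r EF.1 EF.2,
  (forall f, f \in EF.2 -> val f \in D), A (pattern i EF.1) & B (pattern i EF.2)] >].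
pose NN (k : vertices V) := nbhd_set (N (val k)).
pose JJ (k : vertices V) w := `[< exits V N c r (val k) w >].
(* The bonds to decouple. Second witnesses lie in [D], hence in [V], which bounds the number of
   steps by [M]. *)
pose l := [seq e <- enum {: Q} | val e \in D].
have cardV : (#|` V| : nat)%:R >= 0 :> R by [].
set M : R := #|` V|%:R in small cardV *.
set m : R := #|{: vertices V}|%:R; set n : R := (size l)%:R.
have mM : m <= 2 * M by rewrite -natrM ler_nat -cardfE card_vertices.
have nM : n <= M.
  rewrite ler_nat /l -(size_map val); apply: uniq_leq_size.
    by rewrite map_inj_uniq; [rewrite filter_uniq ?enum_uniq | apply: val_inj].
  move=> a /mapP[e]; rewrite mem_filter => /andP[eD _] ->.
  exact: (fsubsetP D_sub_V).
have [m0 n0] : 0 <= m /\ 0 <= n by split.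
have M1 : M = 0 \/ 1 <= M.
  by rewrite /M; case: (#|` V|) => [|k]; [left | right; rewrite ler1n].
have d0 := ltW delta_gt0.
have md : m * delta <= 1.
  apply: le_trans small; rewrite ler_wpM2r //; apply: (le_trans mM).
  by case: M1 => [->|M1]; [rewrite expr2 !mulr0 | rewrite expr2; nra].
have l_uniq : uniq l by rewrite filter_uniq ?enum_uniq.
have TF EF : TT EF -> EF.2 \subset [set b in l]%SET.
  move/asboolP => [_ FD _ _]; apply/fintype.subsetP => e eF.
  by rewrite inE mem_filter FD // mem_enum.
have sep EF b : TT EF -> separated_from (ends := ends) (N := NN) (J := JJ) EF b.
  move/asboolP => [far FD _ _].
  have shield w : (exists x, shields V N c r EF.1 EF.2 b x w) ->
      [exists k, [&& b \notin NN k, clear (N := NN) EF k & JJ k w]].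
    case=> x [xV bN clr ex]; apply/existsP; exists [` xV]%fset.
    rewrite inE /= bN /JJ /=; apply/andP; split; last exact/asboolP.
    rewrite /clear finset.disjoints_subset; apply/fintype.subsetP => e /clr eN.
    by rewrite !inE /=.
  apply/orP; have [s|s] := separation c_gt1 r_ge N_nbhd DV b far FD; [left|right].
    by apply/forallP => w; apply/implyP => /s/shield.
  by apply/forallP => w; apply/implyP => /s/shield.
have wiredK k : mass P (fun w => agree (~: NN k) w [ffun=> true] && JJ k w) <=
  delta ^+ 2 * mass P ((agree (~: NN k))^~ [ffun=> true]) by apply: wired; apply: fsvalP.
have := decoupling P_ge0 P_fkg (markov_mass P_ge0 P_markov) (fun k => @exits_up (val k))
  delta_gt0 P_ones wiredK md i P_sum l_uniq TF sep.
rewrite -/m -/n => main.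
have diagE : pr P (disjoint_occurrence r A B) <= mass P (diag i TT).
  apply: mass_sub => // w /asboolP[E [F [EQ FQ EF AE BF]]].
  pose E' := finset (fun e : Q => (val e \in E) && (w e == i)).
  pose F' := finset (fun e : Q => [&& val e \in F, val e \in D & w e == i]).
  apply/existsP; exists (E', F'); apply/and3P; split=> /=; last 2 first.
  - by apply/forall_inP => e; rewrite inE => /andP[].
  - by apply/forall_inP => e; rewrite inE => /and3P[].
  apply/asboolP; split=> /=.
  - move=> e f x y p; rewrite !inE => /andP[eE _] /and3P[fF _ _] xe yf xy.
    move/bond_dist_geP: EF; apply; [| |exact: xy]; apply/verticesP; first by exists (val e).
    by exists (val f).
  - by move=> f; rewrite inE => /and3P[].
  - apply: AE; apply/restr_eqP => // e eE; rewrite ffunE inE eE /=.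
    by case: (w e); case: (i).
  (* [w1] agrees with [w] on [F], hence is in [B], and it agrees with the pattern of [F'] on [D],
     which is all that [B] sees. *)
  - rewrite BE /=; pose w1 : conf Q := [ffun e => if val e \in F then w e else pattern i F' e].
    have : B w1 by apply: BF; apply/restr_eqP => // e eF; rewrite ffunE eF.
    rewrite BE /=; congr B0; apply/restr_eqP => // e eD; rewrite ffunE.
    by case: ifP => // eF; rewrite ffunE inE eF eD /=; case: (w e); case: (i).
have prodE : pairmass (P := P) i xpredT xpredT TT <= pr P A * pr P B.
  rewrite /pr mulr_suml [leRHS]big_mkcond; apply: ler_sum => w _.
  case: asboolP => [Aw|nAw]; last first.
    rewrite big1 // => w' _; rewrite (_ : theta i TT w w' = false) ?mulr0 //.
    apply/negbTE/negP => /existsP[EF /and3P[/asboolP[_ _ AE _] wE _]]; apply: nAw.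
    exact: pattern_toward AE wE.
  rewrite mulr_sumr [leRHS]big_mkcond; apply: ler_sum => w' _.
  case: asboolP => [Bw|nBw]; first by rewrite ler_piMr ?mulr_ge0 // lern1 leq_b1.
  rewrite (_ : theta i TT w w' = false) ?mulr0 //.
  apply/negbTE/negP => /existsP[EF /and3P[/asboolP[_ _ _ BF] _ wF]]; apply: nBw.
  exact: pattern_toward BF wF.
apply: (le_trans diagE); rewrite -mulrA.
apply: (decoupling_factor (l := size l) m0 mM nM d0 md small); first exact: mass_ge0.
exact: le_trans main prodE.
Qed.

End SameDirection.

(** * Opposite directions, wired measures and the all-open configuration *)

Section Wired.
Context {R : realType} {d : nat} {Q : {fset bond d}} (P : meas R Q).
Implicit Types (w : conf Q) (X : {fset bond d}) (A B : set (conf Q)).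
Hypothesis P_ge0 : forall w, 0 <= P w.

Local Notation ones := ([ffun=> true] : {ffun Q -> bool}).
Local Notation nbhd_set := (nbhd_set Q).

(** Holley's inequality between the law conditioned on the decreasing [B] and the full law, with the
    indicator of [A] as the monotone function. *)
Lemma opposite_direction A B : \sum_w P w = 1 -> FKG_lattice P ->
  increasing_event A -> decreasing_event B -> pr P (A `&` B) <= pr P A * pr P B.
Proof.
move=> P1 P_fkg Aup Bdn.
rewrite (prE P (G := fun w => `[< B w >] && `[< A w >])); last first.
  move=> w; split=> [[Aw Bw]|/andP[/asboolP Bw /asboolP Aw]] //.
  by apply/andP; split; apply/asboolP.
have := @holley_up _ _ P P_ge0 P_fkg (fun w => `[< B w >]) xpredT
  (fun w => `[< A w >]%:R) (fun _ => ler0n _ _) _ _.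
rewrite -!mass_indic (_ : mass P xpredT = 1) // mulr1; apply => s t.
  move=> /asboolP Bs _; apply/asboolP; apply: contrapT => nB.
  by apply: (Bdn _ s) nB _ Bs; apply/cleP/cle_meetl.
move=> _ _; rewrite ler_nat; case: asboolP => // As; rewrite lt0b.
by apply/asboolP; apply: Aup As _; apply/cleP/cle_joinl.
Qed.

Lemma outsideE X w : outside true X w <-> agree (~: nbhd_set X) w ones.
Proof.
rewrite /outside /=; split=> [/restr_rhoP h|/agreeP h].
  apply/agreeP => e; rewrite !inE => eX; rewrite ffunE; apply: h; first exact: fsubsetDl.
  by rewrite inE eX fsvalP.
apply/restr_rhoP; first exact: fsubsetDl.
by move=> e; rewrite inE => /andP[eX _]; rewrite h ?ffunE // !inE.
Qed.

Lemma pr_cond_meas X (G : set (conf X)) :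
  pr (cond_meas true X P) G * mass P ((agree (~: nbhd_set X))^~ ones) =
  mass P (fun w => agree (~: nbhd_set X) w ones && `[< G (restr X w) >]).
Proof.
set Z := mass _ _; have prZ : pr P (outside true X) = Z by apply: prE => w; apply: outsideE.
have [z|nz] := eqVneq Z 0.
  rewrite z mulr0; apply/esym/eqP; rewrite eq_le mass_ge0 // andbT -z.
  by apply: mass_sub => // w /andP[].
rewrite /pr mulr_suml [RHS](partition_big (restr X) (fun h => `[< G h >])) /=; last first.
  by move=> w /andP[].
apply: eq_bigr => h /asboolP Gh; rewrite ffunE /cpr prZ divfK //.
apply: prE => w; split=> [[/= wh /outsideE ->]|/andP[/andP[/outsideE wo _] /eqP wh]] //.
by rewrite wh eqxx andbT; apply/asboolP.
Qed.

Lemma open_bonds_restr X w : (X `<=` Q)%fset ->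
  open_bonds (restr X w) = [fset e in X | state w e]%fset.
Proof.
move=> XQ; apply/fsetP => e; rewrite !inE /=; case eX: (e \in X) => //=.
have -> : e = val [` eX]%fset by [].
by rewrite state_val ffunE.
Qed.

(** Union bound over the remote site in [vertices V], each term being controlled by the decay of
    connectivity beyond distance [r / 16 / c - 1]. *)
Lemma exits_wired (V : {fset bond d}) (N : site d -> {fset bond d}) (c r C lambda : R) x :
  (N x `<=` Q)%fset -> 0 <= r / 16 / c - 1 -> 0 < lambda -> 0 < C ->
  (forall y, x \in vertices (N x) -> y \in vertices (N x) ->
    ((pr (cond_meas true (N x) P) (joined x y))%:E <=
       C%:E * expeR (- (lambda%:E * dist (N x) x y)))%E) ->
  mass P (fun w => agree (~: nbhd_set (N x)) w ones && `[< exits V N c r x w >]) <=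
  #|` vertices V|%:R * (C * expR (- lambda * (r / 16 / c - 1))) *
  mass P ((agree (~: nbhd_set (N x)))^~ ones).
Proof.
move=> NQ rho0 lambda0 C0 decay; set rho := r / 16 / c - 1 in rho0 *.
set Z := mass P ((agree _)^~ ones).
pose target (y : site d) := `[< forall p, is_path (N x) x p y -> rho < (size p)%:R >].
apply: (@le_trans _ _ (\sum_(y : vertices V) mass P (fun w => target (val y) &&
    (agree (~: nbhd_set (N x)) w ones && `[< joined x (val y) (restr (N x) w) >])))).
  apply: mass_union_le => // w /andP[wN /asboolP[y [yV far path]]].
  exists [` yV]%fset; rewrite /= wN /=; apply/andP; split; apply/asboolP => //.
  by case: path => p xy; exists p; rewrite open_bonds_restr.
rewrite cardfE -mulrA mulr_natl -sumr_const; apply: ler_sum => -[y /= yV] _.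
have ex0 : 0 <= C * expR (- lambda * rho) by rewrite mulr_ge0 ?expR_ge0 // ltW.
have Z0 : 0 <= Z by exact: mass_ge0.
have [/asboolP far|nt] := boolP (target y); last first.
  by rewrite [X in X <= _]big1 ?(mulr_ge0 ex0 Z0).
rewrite /= -pr_cond_meas -/Z ler_wpM2r //.
(* Decay is available for vertices of [N x]. A connection longer than [rho >= 0] has at least one
   bond, so its ends are such vertices. *)
have [[xN yN]|nN] := pselect (x \in vertices (N x) /\ y \in vertices (N x)); last first.
  rewrite [X in X <= _]big1 // => h /asboolP[p xy]; case: nN.
  have sub : (open_bonds h `<=` N x)%fset by apply: open_bonds_sub.
  have xyN := is_path_sub sub xy; have := far _ xyN.
  case/lastP: p xyN {xy} => [|p z]; first by move=> _ /(le_lt_trans rho0); rewrite ltxx.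
  case: p => [|a p].
    rewrite /is_path /= andbT => /andP[/adjP[e eN eE] /eqP <-] _.
    by split; apply/verticesP; exists e; rewrite // eE !inE eqxx ?orbT.
  rewrite /is_path rcons_path last_rcons => /andP[/andP[+ +] /eqP <-] _.
  move=> /= /andP[/adjP[e eN eE] _] /adjP[e' eN' eE'].
  split; apply/verticesP; [exists e | exists e'] => //; rewrite ?eE ?eE' !inE eqxx ?orbT //.
rewrite -lee_fin; apply: (le_trans (decay y xN yN)); rewrite EFinM.
apply: lee_wpmul2l; first by rewrite lee_fin ltW.
rewrite -[X in (_ <= X)%E]/(expeR (- lambda * rho)%:E) lee_expeR.
rewrite mulNr EFinN leeN2 EFinM; apply: lee_wpmul2l; first by rewrite lee_fin ltW.
by apply/dist_geP => p /far /ltW.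
Qed.

(* With [r = 1] the neighborhoods of radius [1/4] are empty, so that filling provides
   positive probability for the configuration with all bonds open. *)
Lemma all_open_gt0 (c : R) (NN : set (set (bond d))) (SQ : set {fset bond d})
    (V : {fset bond d}) : (V `<=` Q)%fset -> (2 <= #|` V|)%N ->
  fillable c 1 P SQ NN V -> 0 < P ones.
Proof.
move=> VQ V2 [bs _ fill].
have V0 : (0 < #|` V|)%N by apply: leq_trans V2.
have [_ _ app] := fill (Ordinal V0).
have S0 : [fset e in take 0 bs]%fset = fset0 by rewrite take0; apply/fsetP => e; rewrite !inE.
rewrite /= S0 in app.
have [e eV] : exists e, e \in V.
  by case: (fset_0Vmem V) V0 => [->|[e eV]]; [rewrite cardfs0 | exists e].
have [|W [_ [x [_ _ [_ /fsubsetP Wball]]] blk]] := app e.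
  by rewrite inE (fsubsetP VQ _ eV) !inE.
have W0 : W = fset0.
  apply/fsetP => a; rewrite inE; apply/negP => /Wball; rewrite !inE /= => /andP[_ /forallP ball].
  have near0 y : y \in endpoints a -> x = y.
    move=> ya; have /dist_leP[p xy] := ball [` ya]%fset.
    case: p xy => [|z p]; first by rewrite /is_path /= => /eqP.
    by move=> _; rewrite /= leNgt => /negP[]; rewrite (@lt_le_trans _ _ 1) ?ler1n //; lra.
  have [y [z [yz aE]]] := endpoints_two a.
  by case/eqP: yz; rewrite -(near0 y) ?(near0 z) // aE !inE eqxx ?orbT.
have : cond_defined true (fset0 `|` W)%fset P.
  by case: blk => -[_ _ /(_ true) []].
rewrite /cond_defined W0 fsetU0 (prE P (G := (agree (~: nbhd_set fset0))^~ ones)); last first.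
  by move=> w; apply: outsideE.
rewrite /mass (eq_bigl (fun w => w == ones)) ?big_pred1_eq // => w.
rewrite -agree_setT; congr agree; apply/setP => a; by rewrite !inE.
Qed.

End Wired.

(** * Choice of the constants *)

Section Constants.
Context {R : realType}.
Variables (lambda C c0 : R).
Hypotheses (lambda_gt0 : 0 < lambda) (C_gt0 : 0 < C) (c0_gt1 : 1 < c0).

(** Half the exponent [lambda / (16 * c0)] of the wired bound, since that bound has to be at most
    [delta ^+ 2]. *)
Definition rate : R := lambda / (32 * c0).
(** The factor 2 comes from the at most [2 * M] sites of [V], and [expR lambda] from the [- 1] in
    the radius; adding 1 makes the constant at most its square. *)
Definition prefactor : R := 1 + 2 * C * expR lambda.
(** The three terms secure, in order, [M ^+ 3 <= expR (rate / 2 * r)], [16 * c0 <= r] and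
    [8 * prefactor <= expR (rate / 2 * r)]; the last two use [ln M >= 1 / 2]. *)
Definition threshold : R := 6 / rate + 32 * c0 + 32 * prefactor / rate.

Let c0_gt0 : 0 < c0. Proof. by apply: lt_trans c0_gt1. Qed.

Lemma rate_gt0 : 0 < rate.
Proof. by rewrite divr_gt0 // mulr_gt0. Qed.

Lemma prefactor_ge1 : 1 <= prefactor.
Proof. by rewrite lerDl !mulr_ge0 ?expR_ge0 // ltW. Qed.

Lemma prefactor_gt0 : 0 < prefactor.
Proof. exact: lt_le_trans prefactor_ge1. Qed.

Lemma threshold_gt0 : 0 < threshold.
Proof.
have e0 := rate_gt0; have k0 := prefactor_gt0.
have h1 : 0 < 6 / rate by rewrite divr_gt0.
have h2 : 0 < 32 * prefactor / rate by rewrite divr_gt0 // mulr_gt0.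
by rewrite /threshold; move: c0_gt0; lra.
Qed.

Variables (M r : R).
Hypotheses (M_ge2 : 2 <= M) (r_ge : threshold * ln M <= r).

Let M_gt0 : 0 < M. Proof. by rewrite (lt_le_trans _ M_ge2) ?ltr0n. Qed.

Let ln_ge : 1 / 2 <= ln M.
Proof.
(* [expR x >= 1 + x] at [x = - ln M] gives [ln M >= 1 - 1 / M]. *)
have := expR_ge1Dx (- ln M); rewrite expRN lnK ?posrE //.
have : M^-1 <= 1 / 2 by rewrite div1r lef_pV2 ?posrE ?ltr0n.
lra.
Qed.

Lemma threshold_le : threshold / 2 <= r.
Proof.
apply: le_trans r_ge; have : threshold * (1 / 2) <= threshold * ln M.
  by rewrite ler_wpM2l // ltW // threshold_gt0.
lra.
Qed.

Lemma radius_ge : 16 * c0 <= r.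
Proof.
have t := threshold_le; have e0 := rate_gt0; have k0 := prefactor_gt0.
have h1 : 0 < 6 / rate by rewrite divr_gt0.
have h2 : 0 < 32 * prefactor / rate by rewrite divr_gt0 // mulr_gt0.
by move: t; rewrite /threshold; lra.
Qed.

Lemma decay_sq :
  2 * M * (C * expR (- lambda * (r / 16 / c0 - 1))) <=
  (prefactor * M * expR (- rate * r)) ^+ 2.
Proof.
have -> : - lambda * (r / 16 / c0 - 1) = lambda + (- rate * r + - rate * r).
  by rewrite /rate; field; rewrite gt_eqF.
rewrite 2!expRD; set X := expR (- rate * r).
have X0 : 0 <= X * X by rewrite mulr_ge0 ?expR_ge0.
have -> : 2 * M * (C * (expR lambda * (X * X))) = 2 * C * expR lambda * M * (X * X) by ring.
have -> : (prefactor * M * X) ^+ 2 = (prefactor * M) ^+ 2 * (X * X) by ring.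
rewrite ler_wpM2r //; apply: (@le_trans _ _ (prefactor * M)).
  by rewrite ler_wpM2r ?(ltW M_gt0) // lerDr.
rewrite expr2 ler_peMr ?mulr_ge0 ?(ltW prefactor_gt0) ?(ltW M_gt0) //.
have := ler_pM ler01 ler01 prefactor_ge1 (le_trans (ler1n _ 2) M_ge2).
by rewrite mulr1.
Qed.

(** The union bounds contribute [M ^+ 2] and [delta] another [M]; half of the rate is spent on
    absorbing them. *)
Lemma cube_decay :
  M ^+ 2 * (prefactor * M * expR (- rate * r)) <= prefactor * expR (- (rate / 2) * r).
Proof.
have e0 := rate_gt0; have k0 := prefactor_gt0.
have lnr : 6 * ln M <= rate * r.
  have : 6 / rate * ln M <= r.
    apply: le_trans r_ge; rewrite ler_wpM2r //; first by move: ln_ge; lra.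
    have h2 : 0 < 32 * prefactor / rate by rewrite divr_gt0 // mulr_gt0.
    by rewrite /threshold; move: c0_gt0; lra.
  by rewrite -(ler_pM2l e0) [rate * (_ * _)]mulrA [rate * (6 / _)]mulrC divfK // gt_eqF.
have ME : M = expR (ln M) by rewrite lnK ?posrE.
have -> : M ^+ 2 * (prefactor * M * expR (- rate * r)) =
    prefactor * (M ^+ 3 * expR (- rate * r)) by ring.
rewrite ler_wpM2l ?(ltW k0) // [in M ^+ 3]ME -expRM_natl -expRD ler_expR.
by rewrite -mulr_natl; lra.
Qed.

Lemma decay_small : 8 * M ^+ 2 * (prefactor * M * expR (- rate * r)) <= 1.
Proof.
have e0 := rate_gt0; have k0 := prefactor_gt0.
apply: (@le_trans _ _ (8 * (prefactor * expR (- (rate / 2) * r)))).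
  by rewrite -mulrA ler_pM2l // cube_decay.
rewrite mulNr expRN mulrA ler_pdivrMr ?expR_gt0 // mul1r.
apply: le_trans (expR_ge1Dx _).
have : 32 * prefactor <= 2 * (rate * r).
  have : 32 * prefactor / rate <= 2 * r.
    have h1 : 0 < 6 / rate by rewrite divr_gt0.
    by move: threshold_le; rewrite /threshold; move: c0_gt0; lra.
  by rewrite ler_pdivrMr // => h; apply: (le_trans h); rewrite -mulrA [r * _]mulrC.
by move: k0; lra.
Qed.

End Constants.

(** * Assembly of the theorem *)

Unset Implicit Arguments.

Theorem theorem3p1 (R : realType) (d : nat)
    (RR : set {fset bond d})
    (VV SS : {fset bond d} -> set {fset bond d})
    (MM : meas_coll R d)
    (NN : set (set (bond d))) :
  standard_setup RR VV SS MM ->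
  neighborhood_collection (R := R) RR SS NN ->
  filling_compatible RR VV SS MM NN ->
  (forall (Q : {fset bond d}) (P : meas R Q),
      all_meas RR MM P -> FKG_lattice P) ->
  (forall (Q : {fset bond d}) (P : meas R Q),
      (all_meas RR MM (Q := Q) `|` full_aug SS RR MM (Q := Q)) P ->
      markov_blocking P) ->
  uniform_exp_decay (wired_aug NN RR MM) ->
  exists c c' eps : R, [/\ 0 < c, 0 < c', 0 < eps &
    forall (Q : {fset bond d}), RR Q ->
    forall (P : meas R Q), MM Q P ->
    forall (V : {fset bond d}), VV Q V ->
    forall (r : R), c * ln (#|` V|%:R) <= r ->
    forall (D : {fset bond d}),
      (D `<=` Q)%fset -> (enlarge Q D r `<=` V)%fset ->
    forall (A B : set (conf Q)),
      in_G Q A -> in_G D B ->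
      increasing_event A \/ decreasing_event A ->
      increasing_event B \/ decreasing_event B ->
      pr P (disjoint_occurrence r A B) <=
        (1 + c' * expR (- eps * r)) * pr P A * pr P B].
Proof.
move=> setup [c0 c0_gt1 nbhd] [cf _ filling] fkg markov [C [lambda [C_gt0 lambda_gt0 decay]]].
exists (threshold lambda C c0), (8 * prefactor lambda C), (rate lambda c0 / 2); split.
- exact: threshold_gt0.
- by rewrite mulr_gt0 ?prefactor_gt0.
- by rewrite divr_gt0 ?rate_gt0.
move=> Q RQ P MP V VVQ r r_ge D DQ DV A B _ BD Adir Bdir.
have [/(_ P MP)[P_ge0 P_sum] VS SQ /(_ V VVQ) V2] := setup Q RQ.
have VQ : (V `<=` Q)%fset by apply: SQ; apply: VS.
have P_ones := all_open_gt0 VQ V2 (filling Q RQ V VVQ P MP 1 (lexx 1)).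
have P_fkg := fkg Q P (conj RQ MP).
have P_markov := markov Q P (or_introl (conj RQ MP)).
have pr_ge0 (G : set (conf Q)) : 0 <= pr P G by apply: sumr_ge0.
have opposite (A1 B1 : set (conf Q)) : increasing_event A1 -> decreasing_event B1 ->
    pr P (A1 `&` B1) <= (1 + 8 * prefactor lambda C * expR (- (rate lambda c0 / 2) * r)) *
      pr P A1 * pr P B1.
  move=> up down; apply: le_trans (opposite_direction P_ge0 P_sum P_fkg up down) _.
  rewrite -mulrA ler_peMl ?mulr_ge0 // lerDl mulr_ge0 ?expR_ge0 // mulr_ge0 //.
  exact/ltW/prefactor_gt0.
(* For opposite directions the distance between the witnesses is dropped and FKG suffices. *)
have subAB : pr P (disjoint_occurrence r A B) <= pr P (A `&` B).
  apply: mass_sub => // w /asboolP[E [F [_ _ _ AE BF]]]; apply/asboolP.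
  by split; [apply: AE | apply: BF].
have M_ge2 : (2 : R) <= #|` V|%:R by rewrite ler_nat.
have r16 := radius_ge lambda_gt0 C_gt0 c0_gt1 M_ge2 r_ge.
have c0_gt0 : 0 < c0 by apply: lt_trans c0_gt1.
have r16_gt0 : 0 < r / 16.
  by rewrite divr_gt0 // (lt_le_trans _ r16) // mulr_gt0.
(* One neighborhood of radius [r / 16] per vertex of [Q]; elsewhere the empty set is a default. *)
have /choice[N HN] x : exists X : {fset bond d}, x \in vertices Q ->
    NN [set` X] /\ approx_nbhd c0 (r / 16) Q x X.
  have [xQ|] := boolP (x \in vertices Q); last by exists fset0.
  by have [X h1 h2] := nbhd Q (or_introl RQ) x xQ _ r16_gt0; exists X.
have N_nbhd x : x \in vertices Q -> approx_nbhd c0 (r / 16) Q x (N x).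
  by move=> /HN[].
pose delta := prefactor lambda C * #|` V|%:R * expR (- rate lambda c0 * r).
have k0 : 0 < prefactor lambda C by exact: prefactor_gt0.
have delta_gt0 : 0 < delta.
  by rewrite !mulr_gt0 ?expR_gt0 // (lt_le_trans _ M_ge2).
have wired x : x \in vertices V ->
  mass P (fun w => agree (~: nbhd_set Q (N x)) w [ffun=> true] &&
    `[< exits V N c0 r x w >]) <=
  delta ^+ 2 * mass P ((agree (~: nbhd_set Q (N x)))^~ [ffun=> true]).
  move=> /verticesP[e eV xe].
  have xQ : x \in vertices Q by apply/verticesP; exists e => //; apply: (fsubsetP VQ).
  have [NNx [_ Nball]] := HN x xQ.
  have NQ : (N x `<=` Q)%fset.
    apply: fsubset_trans Nball _; apply/fsubsetP => a; rewrite !inE.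
    by case/andP.
  have rho0 : 0 <= r / 16 / c0 - 1.
    by rewrite subr_ge0 -mulrA -invfM ler_pdivlMr ?mul1r // mulr_gt0.
  (* Positivity of the all-open configuration makes the wired law well defined, hence a member of
     the augmented collection. *)
  have Z0 : 0 < mass P ((agree (~: nbhd_set Q (N x)))^~ [ffun=> true]).
    by apply: mass_gt0 P_ones; rewrite ?agree_refl.
  apply: (le_trans (exits_wired P_ge0 V NQ rho0 lambda_gt0 C_gt0 _)).
    move=> y xN yN; apply: decay xN yN; split=> //; exists Q, P; split=> //.
    rewrite /cond_defined (prE P (G := (agree (~: nbhd_set Q (N x)))^~ [ffun=> true])) //.
    by move=> w; apply: outsideE.
  rewrite ler_wpM2r ?(ltW Z0) //.
  apply: le_trans (decay_sq lambda C_gt0 c0_gt1 r M_ge2).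
  rewrite ler_wpM2r ?mulr_ge0 ?expR_ge0 ?(ltW C_gt0) //.
  by rewrite -natrM ler_nat card_vertices.
have small := decay_small lambda_gt0 C_gt0 c0_gt1 M_ge2 r_ge.
have cube := cube_decay lambda_gt0 C_gt0 c0_gt1 M_ge2 r_ge.
have same i : toward i A -> toward i B -> pr P (disjoint_occurrence r A B) <=
    (1 + 8 * prefactor lambda C * expR (- (rate lambda c0 / 2) * r)) * pr P A * pr P B.
  move=> Ai Bi; apply: (le_trans (same_direction P_ge0 P_sum P_fkg P_markov P_ones
    c0_gt1 r16 N_nbhd DQ DV delta_gt0 wired BD Ai Bi small)).
  rewrite ler_wpM2r ?pr_ge0 // ler_wpM2r ?pr_ge0 // lerD2l.
  by rewrite -[8 * _ * delta]mulrA -[8 * _ * expR _]mulrA ler_pM2l.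
case: Adir Bdir => [Aup|Adn] [Bup|Bdn].
- exact: (same true).
- by apply: (le_trans subAB); apply: opposite.
- by apply: (le_trans subAB); rewrite setIC -mulrA [pr P A * _]mulrC mulrA; apply: opposite.
- exact: (same false).
Qed.
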